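(* Let $1\le k\le n$, let $\lambda=(\mu,\nu)$ be an $(n,k)$-bipartition, and let $s_j=(j,j+1)$, $1\le j<n$, be the Coxeter generators of $S_n$. The $S_n$-action on $R_\lambda^{(k)}$, with respect to its descent basis $\{a_\pi^{(k)}+I_\lambda^{(k)\triangleleft}:\mathrm{Des}(\pi)=A_\lambda\}$, is given by $$s_j(a_\pi^{(k)})=\begin{cases}a_{s_j\pi}^{(k)},&\text{if }|\pi^{-1}(j+1)-\pi^{-1}(j)|>1;\\ a_\pi^{(k)},&\text{if }\pi^{-1}(j+1)=\pi^{-1}(j)+1;\\ -a_\pi^{(k)}-\sum_{\sigma\in A_j(\pi)}a_{\sigma}^{(k)},&\text{if }\pi^{-1}(j+1)=\pi^{-1}(j)-1.\end{cases}$$ Here, for $\pi\in S_n$ with $\mathrm{Des}(\pi)=A_\lambda$ and $\pi^{-1}(j+1)=\pi^{-1}(j)-1$, put $t=\pi^{-1}(j+1)$, $m_1=\max\{i\in\mathrm{Des}(\pi)\cup\{0\}: i\le t-1\}$, $m_2=\min\{i\in\mathrm{Des}(\pi)\cup\{n\}: i\ge t+1\}$ (so that $\pi(t)=j+1$, $\pi(t+1)=j$, and $\{m_1+1,\dots,m_2\}$ is the maximal interval containing $t$ and $t+1$ on which $s_j\pi$ is increasing), and let $A_j(\pi)$ be the set of all $\sigma\in S_n$ satisfying: (1) $\sigma(i)=\pi(i)$ whenever $i\le m_1$ or $i\ge m_2+1$; (2) the sequences $(\sigma(m_1+1),\dots,\sigma(t))$ and $(\sigma(t+1),\dots,\sigma(m_2))$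 are increasing; (3) $\sigma\notin\{\pi,s_j\pi\}$ (i.e., $\{\sigma(t),\sigma(t+1)\}\ne\{j,j+1\}$).
   Context: Let $\mathbf{Q}[\bar x,\bar y]=\mathbf{Q}[x_1,\dots,x_n,y_1,\dots,y_n]$ with $S_n$ acting by $\sigma(x_i)=x_{\sigma(i)}$, $\sigma(y_i)=y_{\sigma(i)}$. For the hook shape $\eta=(1^{k-1},n-k+1)$ let $\Delta_\eta$ be the determinant of the $n\times n$ matrix whose $i$-th row is $(1,y_i,\dots,y_i^{n-k},x_i,\dots,x_i^{k-1})$. Let $\mathbf{H}_\eta$ be the $\mathbf{Q}$-span of all partial derivatives (of all orders, including order $0$) of $\Delta_\eta$. Let $\langle f,g\rangle$ be the constant term of $f(\partial_{x_1},\dots,\partial_{x_n};\partial_{y_1},\dots,\partial_{y_n})\,g(\bar x;\bar y)$, let $J_\eta=\mathbf{H}_\eta^\perp$ with respect to $\langle\ ,\ \rangle$ (an $S_n$-invariant ideal), and $\mathbf{H}'_\eta=\mathbf{Q}[\bar x,\bar y]/J_\eta$. For $\pi\in S_n$ let $\mathrm{Des}(\pi)=\{1\le i\le n-1:\pi(i)>\pi(i+1)\}$; let $d_i=|\mathrm{Des}(\pi)\cap\{i,\dots,k-1\}|$ for $1\le i<k$, $d_k=0$, $d_i=|\mathrm{Des}(\pi)\cap\{k,\dots,i-1\}|$ for $k<i\le n$. The $k$-th descent monomial of $\pi$ is $a_\pi^{(k)}=\prod_{i=1}^{k-1}x_{\pi(i)}^{d_i}\prod_{i=k+1}^{n}y_{\pi(i)}^{d_i}$.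 Its exponent bipartition is $\lambda(a_\pi^{(k)})=((d_1,\dots,d_{k-1},0),(d_n,d_{n-1},\dots,d_{k+1},0))$. An $(n,k)$-bipartition is a pair $\lambda=(\mu,\nu)$ of partitions $\mu=(\mu_1\ge\cdots\ge\mu_{k-1}\ge\mu_k=0)$, $\nu=(\nu_1\ge\cdots\ge\nu_{n-k}\ge\nu_{n-k+1}=0)$ with $\mu_i-\mu_{i+1}\in\{0,1\}$ for $1\le i\le k-1$ and $\nu_i-\nu_{i+1}\in\{0,1\}$ for $1\le i\le n-k$. Put $A_\lambda=\{1\le i<n:\mu_i-\mu_{i+1}=1\text{ or }\nu_{n-i}-\nu_{n-i+1}=1\}$, where the first condition applies to $i<k$ and the second to $i\ge k$ (the indices for which the entries are defined). For bipartitions, $(\mu^1,\nu^1)\trianglelefteq(\mu^2,\nu^2)$ means $\mu^1\trianglelefteq\mu^2$ and $\nu^1\trianglelefteq\nu^2$ in dominance order of partitions; $\triangleleft$ means $\trianglelefteq$ and not equal. Put $I_\lambda^{(k)\trianglelefteq}=\mathrm{span}_{\mathbf{Q}}\{a_\pi^{(k)}+J_\eta:\pi\in S_n,\ \lambda(a_\pi^{(k)})\trianglelefteq\lambda\}$ and $I_\lambda^{(k)\triangleleft}=\mathrm{span}_{\mathbf{Q}}\{a_\pi^{(k)}+J_\eta:\pi\in S_n,\ \lambda(a_\pi^{(k)})\triangleleft\lambda\}$, which are $S_n$-invariant subspaces of $\mathbf{H}'_\eta$, and $R_\lambda^{(k)}=I_\lambda^{(k)\trianglelefteq}/I_\lam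bda^{(k)\triangleleft}$.
   Formalization: In the third case a_σ, for σ in A_j(π), is replaced by the monomial with variables placed by σ but exponents d_i computed from A_λ instead of Des(σ); it equals a_σ if Des(σ)=A_λ. The literal formula fails for n=k=4, π=3214, j=1. *)

(* Defs.v *)
From HB Require Import structures.
From mathcomp Require Import all_boot all_order all_fingroup all_algebra.
From mathcomp Require Import generic_quotient ring_quotient.
From mathcomp Require Import boolp ssrcomplements mpoly.

Set Implicit Arguments.
Unset Strict Implicit.
Unset Printing Implicit Defensive.

Import GRing.Theory.
Local Open Scope ring_scope.
Local Open Scope quotient_scope.

(* Membership is made boolean with excluded middle (asbool), so that spans can
   be fed to the quotient construction of ring_quotient. *)
Section Span.
Variable V : lmodType rat.

Definition lspan (X : V -> Prop) : {pred V} := fun v =>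
  `[< exists (s : seq V) (c : V -> rat),
        (forall x, x \in s -> X x) /\ v = \sum_(x <- s) c x *: x >].

Lemma lspan_seq (X : V -> Prop) (s : seq (rat * V)) :
  (forall p, p \in s -> X p.2) -> \sum_(p <- s) p.1 *: p.2 \in lspan X.
Proof.
move=> sX; apply/asboolP.
exists (undup [seq p.2 | p <- s]), (fun x => \sum_(p <- s | p.2 == x) p.1).
split=> [x|]; first by rewrite mem_undup => /mapP[p ps ->]; exact: sX.
under [RHS]eq_bigr do rewrite scaler_suml.
rewrite (exchange_big_dep predT) //= big_seq_cond [RHS]big_seq_cond.
apply: eq_bigr => p /andP[ps _].
rewrite -big_filter (_ : filter _ _ = [:: p.2]) ?big_seq1 //.
rewrite (eq_filter (a2 := pred1 p.2)); last by move=> x; rewrite /= eq_sym.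
by rewrite filter_pred1_uniq ?undup_uniq // mem_undup map_f.
Qed.

Lemma lspanP (X : V -> Prop) v :
  reflect (exists s : seq (rat * V),
             (forall p, p \in s -> X p.2) /\ v = \sum_(p <- s) p.1 *: p.2)
          (v \in lspan X).
Proof.
apply: (iffP idP) => [/asboolP[s [c [sX ->]]]|[s [sX ->]]]; last exact: lspan_seq.
exists [seq (c x, x) | x <- s]; split=> [p /mapP[x xs ->]|]; first exact: sX.
by rewrite big_map.
Qed.

Lemma lspan_submod (X : V -> Prop) : submod_closed (lspan X).
Proof.
split=> [|a u v /lspanP[s [sX ->]] /lspanP[t [tX ->]]].
  by apply/lspanP; exists [::]; rewrite big_nil.
apply/lspanP; exists ([seq (a * p.1, p.2) | p <- s] ++ t); split=> [p|].
  by rewrite mem_cat => /orP[/mapP[q qs ->]|/tX//]; exact: (sX _ qs).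
rewrite big_cat big_map scaler_sumr /=; congr (_ + _).
by apply: eq_bigr => p _; rewrite scalerA.
Qed.

HB.instance Definition _ (X : V -> Prop) :=
  GRing.isSubmodClosed.Build rat V (lspan X) (lspan_submod X).

Definition is_basis (I : finType) (P : pred I) (b : I -> V) (S : {pred V}) :=
  (forall v, v \in S <-> exists c : I -> rat, v = \sum_(i | P i) c i *: b i)
  /\ (forall c : I -> rat,
        \sum_(i | P i) c i *: b i = 0 -> forall i, P i -> c i = 0).

End Span.

(* ring_quotient only provides the additive group structure on the quotient. *)
Section QuotientModule.
Variables (V : lmodType rat) (S : {pred V}) (S_sub : submod_closed S).

HB.instance Definition _ := GRing.isZmodClosed.Build V S (GRing.submod_closedB S_sub).

Definition qmod := Quotient.quot (GRing.ZmodClosed.clone V S _).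
HB.instance Definition _ := GRing.Zmodule.on qmod.
HB.instance Definition _ := EqQuotient.on qmod.

Definition qclass (v : V) : qmod := \pi_qmod v.

Lemma qclassP u v : reflect (qclass u = qclass v) (u - v \in S).
Proof. by rewrite Quotient.idealrBE; exact: eqP. Qed.

Lemma qclassB : {morph qclass : u v / u - v}.
Proof. by move=> u v; rewrite /qclass (raddfB \pi_qmod). Qed.

Definition qscale (a : rat) (r : qmod) : qmod := qclass (a *: repr r).

Lemma qclass_repr (r : qmod) : qclass (repr r) = r.
Proof. exact: reprK. Qed.

Lemma qclassZ a v : qclass (a *: v) = qscale a (qclass v).
Proof.
by apply/qclassP; rewrite -scalerBr -[_ *: _]addr0; apply: S_sub.2;
  last exact: S_sub.1; apply/qclassP; rewrite qclass_repr.
Qed.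

Lemma qclassD : {morph qclass : u v / u + v}.
Proof. by move=> u v; rewrite /qclass (raddfD \pi_qmod). Qed.

Lemma qscaleA a b r : qscale a (qscale b r) = qscale (a * b) r.
Proof. by rewrite -(qclass_repr r) -!qclassZ scalerA. Qed.
Lemma qscale1 : left_id 1 qscale.
Proof. by move=> r; rewrite -{1}(qclass_repr r) -qclassZ scale1r qclass_repr. Qed.
Lemma qscaleDr : right_distributive qscale +%R.
Proof.
move=> a r s; rewrite -(qclass_repr r) -(qclass_repr s) -qclassD -!qclassZ.
by rewrite scalerDr qclassD.
Qed.
Lemma qscaleDl r : {morph qscale^~ r : a b / a + b}.
Proof. by move=> a b; rewrite -(qclass_repr r) -!qclassZ scalerDl qclassD. Qed.

HB.instance Definition _ := GRing.Zmodule_isLmodule.Build rat qmod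
  qscaleA qscale1 qscaleDr qscaleDl.

(* The map r |-> qclass (f v), for v a representative of r: it is computed on the
   chosen representative [repr r], hence is the map induced by f on the
   quotient as soon as f preserves S (see [qmapE]). *)
Definition qmap (f : V -> V) (r : qmod) : qmod := qclass (f (repr r)).

Lemma qmapE (f : V -> V) : {morph f : u v / u - v} -> {homo f : v / v \in S} ->
  forall v, qmap f (qclass v) = qclass (f v).
Proof.
by move=> fB fS v; apply/qclassP; rewrite -fB fS //; apply/qclassP; rewrite qclass_repr.
Qed.

End QuotientModule.

Section GarsiaHaiman.
Variables n k : nat.

(* Q[x_1..x_n, y_1..y_n]; the index i : 'I_n stands for i + 1. *)
Definition polyxy := {mpoly rat[n + n]}.
Definition xv (i : 'I_n) : polyxy := 'X_(lshift n i).
Definition yv (i : 'I_n) : polyxy := 'X_(rshift n i).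

Definition actxy (s : 'S_n) (p : polyxy) : polyxy :=
  p \mPo [tuple match split i with inl a => xv (s a) | inr b => yv (s b) end
         | i < n + n].

(* Columns 1, y, ..., y^(n-k), x, ..., x^(k-1). *)
Definition Delta : polyxy :=
  \det (\matrix_(i < n, j < n)
          (if (j <= n - k)%N then yv i ^+ j else xv i ^+ (j - (n - k)))).

Definition Heta : {pred polyxy} :=
  lspan (fun g : polyxy => exists m : 'X_{1..n + n}, g = Delta^`M[m]).

Definition diffop (f g : polyxy) : polyxy :=
  \sum_(m <- msupp f) f@_m *: g^`M[m].
Definition pairing (f g : polyxy) : rat := (diffop f g)@_0%MM.

Definition Jeta : {pred polyxy} := fun f =>
  `[< forall g, g \in Heta -> pairing f g = 0 >].

Lemma diffopwE w f g : (msize f <= w)%N ->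
  diffop f g = \sum_(m : 'X_{1..(n + n) < w}) f@_m *: g^`M[m].
Proof.
move=> le_fw; pose P (m : 'X_{1..(n + n) < w}) := val m \in msupp f.
rewrite /diffop [RHS](bigID P) {}/P /= addrC [X in X + _]big1 ?add0r; last first.
  by move=> m /memN_msupp_eq0 ->; rewrite scale0r.
rewrite (big_mksub 'X_{1..(n + n) < w}) //=; first exact: msupp_uniq.
by move=> m /msize_mdeg_lt /leq_trans; apply.
Qed.

Lemma pairing_linear g a f1 f2 :
  pairing (a *: f1 + f2) g = a * pairing f1 g + pairing f2 g.
Proof.
pose w := maxn (msize (a *: f1 + f2)) (maxn (msize f1) (msize f2)).
rewrite /pairing !(@diffopwE w) ?leq_max ?leqnn ?orbT //.
rewrite -mcoeffZ -mcoeffD scaler_sumr -big_split /=; congr (_ @_ _).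
by apply: eq_bigr => m _; rewrite mcoeffD mcoeffZ scalerDl scalerA.
Qed.

Lemma Jeta_submod : submod_closed Jeta.
Proof.
split=> [|a u v /asboolP Ju /asboolP Jv]; apply/asboolP => g Hg.
  by rewrite /pairing /diffop msupp0 big_nil mcoeff0.
by rewrite pairing_linear Ju // Jv // mulr0 addr0.
Qed.

HB.instance Definition _ := GRing.isSubmodClosed.Build rat polyxy Jeta Jeta_submod.

Definition Heta' := qmod Jeta_submod.
HB.instance Definition _ := GRing.Lmodule.on Heta'.
Definition clJ (f : polyxy) : Heta' := qclass _ f.
Definition actH (s : 'S_n) : Heta' -> Heta' := qmap (actxy s).

(* Positions 1 <= i < n are the elements of 'I_n of value i (0 is never used),
   so that sets of positions read as in the usual 1-based one-line notation;
   the values pi(i), pi(i+1) are those of pi at the ordinals i-1 and i. *)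
Definition Des (pi : 'S_n) : {set 'I_n} :=
  [set i : 'I_n | [exists p : 'I_n, (p.+1 == i)%N && (pi i < pi p)%N]].

(* d_i for a descent set D, 1 <= i <= n; both branches give d_k = 0. *)
Definition dexp (D : {set 'I_n}) (i : nat) : nat :=
  if (i <= k)%N then #|[set j in D | (i <= j < k)%N]|
  else #|[set j in D | (k <= j < i)%N]|.

(* The exponents d_i are read off D and the variables off pi. *)
Definition dmon (D : {set 'I_n}) (pi : 'S_n) : polyxy :=
  (\prod_(p < n | (p.+1 < k)%N) xv (pi p) ^+ dexp D p.+1)
  * (\prod_(p < n | (k < p.+1)%N) yv (pi p) ^+ dexp D p.+1).

Definition amon (pi : 'S_n) : polyxy := dmon (Des pi) pi.

Definition lam_of (pi : 'S_n) : seq nat * seq nat :=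
  ([seq dexp (Des pi) i | i <- iota 1 k],
   [seq dexp (Des pi) (n - i) | i <- iota 0 (n - k).+1]).

(* 1-based entry of a sequence of parts. *)
Definition part (s : seq nat) (i : nat) : nat := nth 0%N s i.-1.

Definition is_bipartition (lam : seq nat * seq nat) : Prop :=
  let: (mu, nu) := lam in
  [/\ size mu = k, sorted geq mu, part mu k = 0%N &
      forall i, (1 <= i <= k - 1)%N -> (part mu i - part mu i.+1 <= 1)%N]
  /\ [/\ size nu = (n - k).+1, sorted geq nu, part nu (n - k).+1 = 0%N &
      forall i, (1 <= i <= n - k)%N -> (part nu i - part nu i.+1 <= 1)%N].

Definition Alam (lam : seq nat * seq nat) : {set 'I_n} :=
  [set i : 'I_n | (0 < i)%N &&
     (if (i < k)%N then (part lam.1 i - part lam.1 i.+1 == 1)%N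
      else (part lam.2 (n - i) - part lam.2 (n - i).+1 == 1)%N)].

(* Dominance compares partitions of the same integer. *)
Definition domle (s t : seq nat) : bool :=
  (sumn s == sumn t) &&
  [forall m : 'I_(maxn (size s) (size t)).+1, (sumn (take m s) <= sumn (take m t))%N].

Definition bidom (l1 l2 : seq nat * seq nat) : bool := domle l1.1 l2.1 && domle l1.2 l2.2.

Definition Ile (lam : seq nat * seq nat) : {pred Heta'} :=
  lspan (fun v => exists2 pi : 'S_n, bidom (lam_of pi) lam & v = clJ (amon pi)).
Definition Ilt (lam : seq nat * seq nat) : {pred Heta'} :=
  lspan (fun v => exists2 pi : 'S_n,
           bidom (lam_of pi) lam && (lam_of pi != lam) & v = clJ (amon pi)).

Definition Ilt_submod lam : submod_closed (Ilt lam) := lspan_submod _.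

(* The quotient of Ile by Ilt is the subspace Rlam of the quotient of Heta' by
   Ilt: the cosets u + Ilt with u in Ile. *)
Definition Qlam (lam : seq nat * seq nat) := qmod (Ilt_submod lam).
HB.instance Definition _ lam := GRing.Lmodule.on (Qlam lam).
Definition clI lam (u : Heta') : Qlam lam := qclass _ u.
Definition Rlam (lam : seq nat * seq nat) : {pred Qlam lam} := fun r =>
  `[< exists2 u, u \in Ile lam & r = clI lam u >].
Definition actR lam (s : 'S_n) : Qlam lam -> Qlam lam := qmap (actH s).

(* [camon lam pi] is the coset a_pi + Ilt. [cmon lam pi] is the coset of the
   monomial with exponents prescribed by lam and variables arranged by pi; it is
   a_pi + Ilt when Des pi = Alam lam (see [camonE]). The sum in the action
   formula runs over the permutations sg of [Aset], for which Des sg may be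
   strictly smaller than Alam lam; its terms are to be read as [cmon lam sg].
   With a_sg itself the degrees would not match: for n = k = 4, pi = 3214 and
   j = 1, [Aset] is {3412}, the polynomial s_1 a_pi = x_3^2 x_1 has degree 3,
   a_3412 = x_3 x_4 has degree 2, and the term needed is x_3^2 x_4. *)
Definition cmon (lam : seq nat * seq nat) (pi : 'S_n) : Qlam lam :=
  clI lam (clJ (dmon (Alam lam) pi)).
Definition camon (lam : seq nat * seq nat) (pi : 'S_n) : Qlam lam :=
  clI lam (clJ (amon pi)).

Lemma camonE lam pi : Des pi = Alam lam -> cmon lam pi = camon lam pi.
Proof. by rewrite /cmon /camon /amon => ->. Qed.

(* Below j and j' are the ordinals of the values j and j+1; t is the 1-based
   position of j+1 in pi. *)
Definition Aset (pi : 'S_n) (j j' : 'I_n) : {set 'S_n} :=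
  let t := ((pi^-1)%g j').+1 in
  let m1 := (\max_(i in Des pi | (i <= t - 1)%N) i)%N in
  let m2 := (\big[minn/n]_(i in Des pi | (t + 1 <= i)%N) i)%N in
  [set sg : 'S_n |
    [&& [forall p : 'I_n, (p.+1 <= m1)%N || (m2 + 1 <= p.+1)%N ==> (sg p == pi p)],
        [forall p : 'I_n, forall q : 'I_n,
           [&& m1 + 1 <= p.+1, p < q & q.+1 <= t]%N ==> (sg p < sg q)%N],
        [forall p : 'I_n, forall q : 'I_n,
           [&& t + 1 <= p.+1, p < q & q.+1 <= m2]%N ==> (sg p < sg q)%N] &
        sg \notin [set pi; (pi * tperm j j')%g]]].

End GarsiaHaiman.

Arguments actxy {n} s p.
Arguments clJ {n k} f.
Arguments actH {n k} s r.
Arguments clI {n k} lam u.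
Arguments Heta n k : clear implicits.
Arguments Jeta n k : clear implicits.
Arguments Ile n k lam : clear implicits.
Arguments Ilt n k lam : clear implicits.
Arguments Rlam n k lam : clear implicits.
Arguments actR {n k lam} s r.
Arguments Aset {n} pi j j'.
Arguments cmon {n} k lam pi.
Arguments camon {n} k lam pi.

(* Main.v *)
Require Import Defs.
From mathcomp Require Import all_boot all_order all_fingroup all_algebra.
From mathcomp Require Import boolp mpoly zify.
Set Implicit Arguments.
Unset Strict Implicit.
Unset Printing Implicit Defensive.
Import GRing.Theory Num.Theory.
Local Open Scope ring_scope.

(** Let <f, Delta> be the constant term of f(d) Delta. Since differentiation is adjoint to
    multiplication, f is in J exactly when <m f, Delta> = 0 for all monomials m ([JetaP]).
    The functional is alternating under S_n, and on monomials it is, up to factorials, the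
    coefficient in Delta ([pair_Delta_mono]). Hence J contains x_i y_i, the products of k
    distinct x's, the products of n - k + 1 distinct y's ([mono_Jeta]) and the elementary
    symmetric polynomials of positive degree in x and in y ([esymx_Jeta], [esymy_Jeta]).

    These elements suffice to straighten. The exponents of a monomial not in J, sorted by a
    word pi, decrease in x up to position k and increase in y from there. If a drop exceeds
    what the descents of pi ask for, the layer of letters on the larger side of the drop is moved
    elsewhere with the help of an elementary symmetric polynomial. The exponents only go down
    in dominance order, and a strictly convex weight proves termination ([straighten]). This
    gives the invariance of the spaces I_lambda: permuting the letters of a_pi does not
    change its sorted exponents.

    Linear independence of the a_pi needs no dimension formula. The complementary monomial b_pi,
    built on the ascents of pi, satisfies <a_pi b_pi, Delta> <> 0, and the matrix
    <a_pi b_sg, Delta> is triangular: a nonzero entry forces the exponents of a_pi to dominate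
    those of a_sg, and for equal descent sets forces pi <= sg lexicographically
    ([pair_Delta_amon_dual], [amon_free]). With straightening this gives the descent basis of
    R_lambda ([camon_basis]).

    The first two cases of the action formula are equalities of monomials. The third is a
    Garnir relation ([garnir]): remove from a_pi the layer of the descent t and multiply by the
    elementary symmetric polynomial of the degree of that layer. Modulo J the product is zero,
    and its terms are indexed by the sets that replace the layer. The sets lying between the
    prefixes of pi at the neighbouring descents m1 and m2 correspond to the words that
    redistribute the positions m1 + 1, .., m2 increasingly on both sides of t, namely pi, s_j pi and
    the words of A_j(pi); all the other terms are in J or strictly lower in dominance order. *)

(** * Monomials and prefixes of words *)

Section Monomials.
Variable n : nat.
Implicit Types (a b c d : 'I_n -> nat) (s pi : 'S_n).

Definition mexp a b : 'X_{1..n + n} :=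
  [multinom match split i with inl p => a p | inr p => b p end | i < n + n].

Definition mono a b : polyxy n := 'X_[mexp a b].

Lemma mexp_l a b i : mexp a b (lshift n i) = a i.
Proof. by rewrite mnmE (unsplitK (inl i)). Qed.

Lemma mexp_r a b i : mexp a b (rshift n i) = b i.
Proof. by rewrite mnmE (unsplitK (inr i)). Qed.

Lemma mexpK (m : 'X_{1..n + n}) :
  m = mexp (fun i => m (lshift n i)) (fun i => m (rshift n i)).
Proof.
apply/mnmP => i; rewrite -(splitK i).
by case: (split i) => j /=; rewrite ?mexp_l ?mexp_r.
Qed.

Lemma eq_mono a b c d : a =1 c -> b =1 d -> mono a b = mono c d.
Proof.
move=> e1 e2; rewrite /mono; congr 'X_[_]; apply/mnmP => i; rewrite -(splitK i).
by case: (split i) => j /=; rewrite ?mexp_l ?mexp_r.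
Qed.

Lemma mexp_inj a b c d : mexp a b = mexp c d -> a =1 c /\ b =1 d.
Proof.
by move=> e; split=> i; [rewrite -(mexp_l a b) e mexp_l | rewrite -(mexp_r a b) e mexp_r].
Qed.

Lemma monoM a b c d :
  mono a b * mono c d = mono (fun i => a i + c i)%N (fun i => b i + d i)%N.
Proof.
rewrite -mpolyXD; congr 'X_[_]; apply/mnmP => i; rewrite mnmDE -(splitK i).
by case: (split i) => j /=; rewrite ?mexp_l ?mexp_r.
Qed.

Lemma monoE a b : mono a b = (\prod_i xv i ^+ a i) * (\prod_i yv i ^+ b i).
Proof.
rewrite /mono mpolyXE_id big_split_ord /=.
by congr (_ * _); apply: eq_bigr => i _; rewrite ?mexp_l ?mexp_r.
Qed.

Lemma actxy_mono s a b :
  actxy s (mono a b) = mono (fun i => a ((s^-1)%g i)) (fun i => b ((s^-1)%g i)).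
Proof.
rewrite /actxy comp_mpolyX big_split_ord monoE /=.
by congr (_ * _); rewrite [RHS](reindex_inj (@perm_inj _ s)) /=;
  apply: eq_bigr => i _; rewrite tnth_mktuple ?(unsplitK (inl i)) ?(unsplitK (inr i))
  ?mexp_l ?mexp_r permK.
Qed.

Lemma actxyD s : {morph actxy s : f g / f + g}.
Proof. by move=> f g; rewrite /actxy comp_mpolyD. Qed.

Lemma actxyB s : {morph actxy s : f g / f - g}.
Proof. by move=> f g; rewrite /actxy comp_mpolyB. Qed.

Lemma actxyZ s q f : actxy s (q *: f) = q *: actxy s f.
Proof. by rewrite /actxy comp_mpolyZ. Qed.

Lemma actxy_sum s (I : Type) (r : seq I) P (F : I -> polyxy n) :
  actxy s (\sum_(i <- r | P i) F i) = \sum_(i <- r | P i) actxy s (F i).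
Proof. by apply: (big_morph (actxy s)); [exact: actxyD | rewrite /actxy comp_mpoly0]. Qed.

Lemma mono_span (f : polyxy n) :
  f = \sum_(m <- msupp f) f@_m *: mono (fun i => m (lshift n i)) (fun i => m (rshift n i)).
Proof. by rewrite {1}[f]mpolyE; apply: eq_bigr => m _; rewrite /mono -mexpK. Qed.

(** The first m entries of the word of pi, as a set of letters: the layers of a descent
    monomial are such sets or their complements. *)
Definition pfx pi m : {set 'I_n} := [set i | ((pi^-1)%g i < m)%N].

Lemma card_pfx pi m : (m <= n)%N -> #|pfx pi m| = m.
Proof.
move=> le_mn; rewrite -sum1_card (reindex_inj (@perm_inj _ pi)) /=.
rewrite (eq_bigl (fun p : 'I_n => p < m)%N) => [|p]; last by rewrite inE permK.
by rewrite (big_ord_narrow le_mn) sum1_card card_ord.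
Qed.

Lemma card_pfxC pi m : (m <= n)%N -> #|~: pfx pi m| = (n - m)%N.
Proof. by move=> le_mn; rewrite cardsCs setCK card_pfx ?card_ord. Qed.

End Monomials.

(** * The ideal J and the functional f |-> <f, Delta> *)

Section Annihilator.
Variables n k : nat.
Hypotheses (k_gt0 : (0 < k)%N) (le_kn : (k <= n)%N).
Implicit Types (a b c d : 'I_n -> nat) (s pi tau : 'S_n) (f g : polyxy n).

Lemma pairing0 g : pairing (0 : polyxy n) g = 0.
Proof. by rewrite /pairing /diffop msupp0 big_nil mcoeff0. Qed.

Lemma pairingD g : {morph (fun f => pairing f g) : f1 f2 / f1 + f2}.
Proof. by move=> f1 f2; rewrite -[f1]scale1r pairing_linear mul1r scale1r. Qed.

Lemma pairingZ q f g : pairing (q *: f) g = q * pairing f g.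
Proof. by rewrite -[_ *: _]addr0 pairing_linear pairing0 addr0. Qed.

Lemma pairing_sum (I : Type) (r : seq I) P (F : I -> polyxy n) g :
  pairing (\sum_(i <- r | P i) F i) g = \sum_(i <- r | P i) pairing (F i) g.
Proof.
by apply: (big_morph (fun f => pairing f g)); [exact: pairingD | exact: pairing0].
Qed.

Lemma pairingX m g : pairing ('X_[m] : polyxy n) g = (g^`M[m])@_0%MM.
Proof. by rewrite /pairing /diffop msuppX big_seq1 mcoeffX eqxx scale1r. Qed.

(** Differentiation is adjoint to multiplication, which turns orthogonality to all
    derivatives of Delta into a condition on the multiples of f. *)
Lemma pairing_mderivm f g m : pairing f (g^`M[m]) = pairing ('X_[m] * f) g.
Proof.
rewrite [f]mpolyE mulr_sumr !pairing_sum; apply: eq_bigr => m' _.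
by rewrite -scalerAr !pairingZ -mpolyXD !pairingX mderivmDm.
Qed.

Lemma pairing_sumr f (I : Type) (r : seq I) (F : I -> polyxy n) :
  pairing f (\sum_(i <- r) F i) = \sum_(i <- r) pairing f (F i).
Proof.
rewrite [f]mpolyE pairing_sum.
under [RHS]eq_bigr do rewrite pairing_sum.
rewrite exchange_big /=; apply: eq_bigr => m _.
rewrite pairingZ pairingX.
under [RHS]eq_bigr do rewrite pairingZ pairingX.
rewrite -mulr_sumr; congr (_ * _).
by rewrite (raddf_sum (mderivm m)) raddf_sum.
Qed.

Lemma pairingZr q f g : pairing f (q *: g) = q * pairing f g.
Proof.
rewrite [f]mpolyE !pairing_sum mulr_sumr; apply: eq_bigr => m _.
by rewrite !pairingZ !pairingX mderivmZ mcoeffZ mulrCA.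
Qed.

Definition pair_Delta f := pairing f (Delta n k).

(** This makes J an ideal by construction, and reduces every membership in J to the
    vanishing of one linear functional. *)
Lemma JetaP f : f \in Jeta n k <-> forall m, pair_Delta ('X_[m] * f) = 0.
Proof.
split=> [/asboolP Jf m | Jf].
  rewrite /pair_Delta -pairing_mderivm; apply: Jf; apply/lspanP.
  exists [:: (1, (Delta n k)^`M[m])]; split; last by rewrite big_seq1 scale1r.
  by move=> p; rewrite inE => /eqP-> /=; exists m.
apply/asboolP => g /lspanP[t [tX ->]]; rewrite pairing_sumr big_seq big1 // => p pt.
have [m ->] := tX _ pt.
by rewrite pairingZr pairing_mderivm -/(pair_Delta _) Jf mulr0.
Qed.

(** The columns of Delta are 1, y, .., y^(n-k), x, .., x^(k-1); [colx] and [coly] give the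
    exponents of x and y in column j. *)
Definition colx (j : nat) := (if j <= n - k then 0 else j - (n - k))%N.
Definition coly (j : nat) := (if j <= n - k then j else 0)%N.

Lemma col_inj (i j : nat) : colx i = colx j -> coly i = coly j -> i = j.
Proof. by rewrite /colx /coly; do 2!case: ifP; lia. Qed.

Lemma DeltaE :
  Delta n k = \sum_(s : 'S_n) (-1) ^+ s *: mono (fun i => colx (s i)) (fun i => coly (s i)).
Proof.
apply: eq_bigr => s _; rewrite mulr_sign scaler_sign.
suff -> : \prod_i (\matrix_(i, j) (if (j <= n - k)%N then yv i ^+ j
    else xv i ^+ (j - (n - k)))) i (s i) =
    mono (fun i => colx (s i)) (fun i => coly (s i)) :> polyxy n by [].
rewrite monoE -big_split /=; apply: eq_bigr => i _; rewrite mxE /colx /coly.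
by case: ifP => _; rewrite expr0 ?mul1r ?mulr1.
Qed.

Definition matches a b s := [forall i, (a i == colx (s i)) && (b i == coly (s i))].

(** The pairing with Delta reads off a coefficient, up to the factorials produced by
    differentiation. *)
Lemma pair_Delta_mono a b :
  pair_Delta (mono a b) = (\prod_i ((a i)`! * (b i)`!))%:R * \sum_(s | matches a b s) (-1) ^+ s.
Proof.
rewrite /pair_Delta pairingX mcoeff_mderivm addm0 -[LHS]mulr_natl; congr (_%:R * _).
  rewrite big_split_ord /= -big_split; apply: eq_bigr => i _ /=.
  by rewrite mexp_l mexp_r !ffactnn.
rewrite DeltaE raddf_sum [RHS]big_mkcond; apply: eq_bigr => s _ /=.
rewrite mcoeffZ mcoeffX; case: ifP => [/forallP abP|abF].
  rewrite (_ : _ == _) ?mulr1 //; apply/eqP; congr (mexp _ _); apply/funext => i;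
  by case/andP: (abP i) => /eqP e1 /eqP e2.
case: eqP => [/mexp_inj[e1 e2]|]; last by rewrite mulr0.
by case/forallP: abF => i; rewrite e1 e2 !eqxx.
Qed.

Lemma colperm_subproof :
  injective (fun p : 'I_n => inord (if p < k.-1 then n.-1 - p else p.+1 - k)%N : 'I_n.-1.+1).
Proof.
move=> p q /(congr1 val); have := ltn_ord p; have := ltn_ord q => qn pn.
rewrite /= !inordK; [|case: ifP; lia..] => e.
by apply/val_inj; move: e => /=; do 2!case: ifP; lia.
Qed.

(** Read in this order, the columns have the exponents that a word with every possible
    descent gives to its letters: x^(k-1), .., x, 1, y, .., y^(n-k). *)
Lemma colperm : exists r : 'S_n, forall p, colx (r p) = (k.-1 - p)%N /\ coly (r p) = (p.+1 - k)%N.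
Proof.
have nE : n.-1.+1 = n by lia.
pose f (p : 'I_n) := cast_ord nE (inord (if p < k.-1 then n.-1 - p else p.+1 - k)%N : 'I_n.-1.+1).
have f_inj : injective f by move=> p q /cast_ord_inj; exact: colperm_subproof.
exists (perm f_inj) => p; have := ltn_ord p => pn.
rewrite permE /f /= inordK; last by case: ifP; lia.
by rewrite /colx /coly; do 2!case: ifP; lia.
Qed.

Lemma pair_Delta_mono_neq0 a b : pair_Delta (mono a b) != 0 ->
  exists tau, forall p, a (tau p) = (k.-1 - p)%N /\ b (tau p) = (p.+1 - k)%N.
Proof.
rewrite pair_Delta_mono mulf_eq0 negb_or => /andP[_].
have [s /forallP sP _|noS] := pickP (matches a b); last by rewrite big_pred0 ?eqxx.
have [r rP] := colperm; exists (r * s^-1)%g => p; rewrite permM.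
by case/andP: (sP ((s^-1)%g (r p))) => /eqP-> /eqP->; rewrite permKV.
Qed.

(** The exponents of distinct columns are distinct, so that exactly one term of the
    determinant contributes: nothing can cancel. *)
Lemma pair_Delta_top tau :
  pair_Delta (mono (fun i => k.-1 - (tau^-1)%g i)%N (fun i => ((tau^-1)%g i).+1 - k)%N) != 0.
Proof.
have [r rP] := colperm.
rewrite pair_Delta_mono (big_pred1 (tau^-1 * r)%g) => [|s].
  rewrite mulf_neq0 ?signr_eq0 // pnatr_eq0 -lt0n prodn_gt0 // => i.
  by rewrite muln_gt0 !fact_gt0.
apply/forallP/eqP => [sP|-> i]; last first.
  by rewrite permM; case: (rP ((tau^-1)%g i)) => -> ->; rewrite !eqxx.
apply/permP => i; rewrite permM; apply/val_inj/col_inj; case/andP: (sP i) => /eqP e1 /eqP e2;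
by case: (rP ((tau^-1)%g i)) => rx ry; rewrite -?e1 -?e2 ?rx ?ry.
Qed.

(** The determinant is alternating in its rows. *)
Lemma pair_Delta_act s f : pair_Delta (actxy s f) = (-1) ^+ s * pair_Delta f.
Proof.
rewrite [f]mono_span actxy_sum /pair_Delta !pairing_sum mulr_sumr; apply: eq_bigr => m _.
rewrite actxyZ !pairingZ mulrCA; congr (_ * _); rewrite actxy_mono -!/(pair_Delta _) !pair_Delta_mono.
rewrite mulrCA; congr (_%:R * _).
  by rewrite (reindex_inj (@perm_inj _ s)) /=; apply: eq_bigr => i _; rewrite permK.
rewrite (reindex_inj (mulgI s^-1%g)) mulr_sumr /=.
apply: eq_big => [t|t _]; last by rewrite odd_permM odd_permV signr_addb.
by apply/forallP/forallP => tP i; [move: (tP (s i)) | move: (tP ((s^-1)%g i))];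
  rewrite permM ?permK ?permKV.
Qed.

Lemma Jeta_act s f : f \in Jeta n k -> actxy s f \in Jeta n k.
Proof.
move=> Jf; apply/JetaP => m.
have -> : 'X_[m] * actxy s f = actxy s (actxy (s^-1)%g 'X_[m] * f).
  rewrite [RHS]rmorphM /=; congr (_ * _).
  rewrite -/(actxy s _) -/(actxy (s^-1)%g _) [m]mexpK -!/(mono _ _) !actxy_mono invgK.
  by apply: eq_mono => i; rewrite permKV.
rewrite pair_Delta_act [m]mexpK -/(mono _ _) actxy_mono.
by have /JetaP-> := Jf; rewrite mulr0.
Qed.

Lemma mono_pair_Jeta f : (forall a b, pair_Delta (mono a b * f) = 0) -> f \in Jeta n k.
Proof. by move=> f0; apply/JetaP => m; rewrite [m]mexpK; apply: f0. Qed.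

(** A monomial that divides no monomial of Delta kills Delta as a differential operator. *)
Lemma mono_Jeta a b :
  (forall tau, ~ (forall p, (a (tau p) <= k.-1 - p)%N /\ (b (tau p) <= p.+1 - k)%N)) ->
  mono a b \in Jeta n k.
Proof.
move=> noT; apply: mono_pair_Jeta => c d; apply/eqP; rewrite monoM.
have [//|/pair_Delta_mono_neq0[tau tauP]] := boolP (_ == 0).
by case: (noT tau) => p; case: (tauP p) => <- <-; rewrite !leq_addl.
Qed.

Lemma xy_Jeta a b i : (0 < a i)%N -> (0 < b i)%N -> mono a b \in Jeta n k.
Proof.
move=> ai bi; apply: mono_Jeta => tau /(_ ((tau^-1)%g i)); rewrite permKV; lia.
Qed.

Lemma xsupp_Jeta a b : (k <= #|[set i | (0 < a i)%N]|)%N -> mono a b \in Jeta n k.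
Proof.
move=> le_k; apply: mono_Jeta => tau tauP.
suff : (#|[set i | (0 < a i)%N]| <= k.-1)%N by lia.
rewrite -[leqRHS](card_pfx tau) ?(leq_trans (leq_pred k)) //; apply/subset_leq_card.
apply/subsetP => i; rewrite !inE; case: (tauP ((tau^-1)%g i)); rewrite permKV; lia.
Qed.

Lemma ysupp_Jeta a b : (n - k < #|[set i | (0 < b i)%N]|)%N -> mono a b \in Jeta n k.
Proof.
move=> lt_nk; apply: mono_Jeta => tau tauP.
suff : (#|[set i | (0 < b i)%N]| <= n - k)%N by lia.
rewrite -[leqRHS](card_pfxC tau) //; apply/subset_leq_card/subsetP => i.
rewrite !inE; case: (tauP ((tau^-1)%g i)); rewrite permKV; lia.
Qed.

(** The value is equal to its opposite. *)
Lemma pair_Delta_tperm f (i l : 'I_n) : i != l -> actxy (tperm i l) f = f -> pair_Delta f = 0.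
Proof.
move=> il fE; have := pair_Delta_act (tperm i l) f.
rewrite fE odd_tperm il expr1 mulN1r => /eqP.
by rewrite -addr_eq0 -mulr2n mulrn_eq0 /= => /eqP.
Qed.

Lemma act_sum_card s (r : nat) (F : {set 'I_n} -> polyxy n) :
  (forall Z : {set 'I_n}, actxy s (F Z) = F (s @: Z)) ->
  actxy s (\sum_(Z : {set 'I_n} | #|Z| == r) F Z) = \sum_(Z : {set 'I_n} | #|Z| == r) F Z.
Proof.
move=> sF; rewrite actxy_sum.
under eq_bigr do rewrite sF.
rewrite [RHS](reindex_inj (imset_inj (@perm_inj _ s))) /=.
by apply: eq_bigl => Z; rewrite card_imset //; exact: perm_inj.
Qed.

(** Two letters with the same exponents can be exchanged without changing the
    symmetrized sum, whose pairing with Delta therefore vanishes. *)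
Lemma pair_Delta_sum_collision (r : nat) (u v : 'I_n -> nat) (h g : {set 'I_n} -> 'I_n -> nat)
    (i l : 'I_n) : i != l -> u i = u l -> v i = v l ->
  (forall (Z : {set 'I_n}) j, h (tperm i l @: Z) j = h Z (tperm i l j)) ->
  (forall (Z : {set 'I_n}) j, g (tperm i l @: Z) j = g Z (tperm i l j)) ->
  pair_Delta (\sum_(Z : {set 'I_n} | #|Z| == r)
         mono (fun i => u i + h Z i)%N (fun i => v i + g Z i)%N) = 0.
Proof.
move=> il uE vE hE gE; apply: (pair_Delta_tperm il); apply: act_sum_card => Z.
rewrite actxy_mono; apply: eq_mono => j; rewrite tpermV ?hE ?gE;
by congr (_ + _)%N; case: tpermP => [->|->|].
Qed.

Lemma in_tperm_imset (i l j : 'I_n) (Z : {set 'I_n}) :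
  (j \in tperm i l @: Z) = (tperm i l j \in Z).
Proof. by rewrite -{1}[j](tpermK i l) mem_imset //; exact: perm_inj. Qed.

Lemma pair_Delta_sum_neq0 (r : nat) (u v : {set 'I_n} -> 'I_n -> nat) :
  pair_Delta (\sum_(Z : {set 'I_n} | #|Z| == r) mono (u Z) (v Z)) != 0 ->
  exists (Z : {set 'I_n}) tau, #|Z| = r /\ forall p, u Z (tau p) = (k.-1 - p)%N /\ v Z (tau p) = (p.+1 - k)%N.
Proof.
move=> f_neq0.
have /exists_inP[Z /eqP Zr /pair_Delta_mono_neq0[tau tauP]] :
    [exists (Z : {set 'I_n} | #|Z| == r), pair_Delta (mono (u Z) (v Z)) != 0].
  apply: contraNT f_neq0 => /exists_inPn noZ.
  by rewrite /pair_Delta pairing_sum big1 // => Z /noZ; rewrite negbK => /eqP.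
by exists Z, tau.
Qed.

(** Elementary symmetric polynomials in x annihilate Delta. If some term of the sum had a
    nonzero pairing, raising the exponents on Z would produce the exponents of the columns
    of Delta; going down the columns, the last letter of Z then had, before it was raised, the
    exponents of the next letter, and the collision forces the whole sum to vanish. *)
Lemma esymx_Jeta a b r : (0 < r)%N ->
  \sum_(Z : {set 'I_n} | #|Z| == r) mono (fun i => a i + (i \in Z))%N b \in Jeta n k.
Proof.
move=> r_gt0; apply: mono_pair_Jeta => c d; rewrite mulr_sumr.
pose u i := (c i + a i)%N; pose v i := (d i + b i)%N.
rewrite (eq_bigr (fun Z : {set 'I_n} => mono (fun i => u i + (i \in Z))%N (fun i => v i + 0)%N));
  last by move=> Z _; rewrite monoM; apply: eq_mono => i; rewrite ?addnA ?addn0.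
apply/eqP; apply: contraT => /[dup] pair_neq0 /pair_Delta_sum_neq0[Z [tau [Zr tauP]]].
have /card_gt0P[i0 i0Z] : (0 < #|Z|)%N by rewrite Zr.
have tZ : tau ((tau^-1)%g i0) \in Z by rewrite permKV.
(* The last position p of tau with entry in Z: positions p and p + 1 carry x-exponents
   k - 1 - p and k - 2 - p, but the first includes a contribution 1 from Z. *)
have [p pZ pmax] := arg_maxnP (P := fun p => tau p \in Z) (fun p : 'I_n => p : nat) tZ.
have [xp yp] := tauP p; rewrite pZ in xp.
have lt_qn : (p.+1 < n)%N by lia.
pose q := Ordinal lt_qn; have [xq yq] := tauP q.
have qZ : tau q \notin Z by apply/negP => /pmax /=; lia.
rewrite (negPf qZ) /= in xq; rewrite /= in yq.
case/eqP: pair_neq0; apply: (@pair_Delta_sum_collision r u v _ _ (tau p) (tau q)).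
- by rewrite (inj_eq perm_inj) -val_eqE /=; lia.
- lia.
- lia.
- by move=> Y j; rewrite in_tperm_imset.
- by [].
Qed.

Lemma esymy_Jeta a b r : (0 < r)%N ->
  \sum_(Z : {set 'I_n} | #|Z| == r) mono a (fun i => b i + (i \in Z))%N \in Jeta n k.
Proof.
move=> r_gt0; apply: mono_pair_Jeta => c d; rewrite mulr_sumr.
pose u i := (c i + a i)%N; pose v i := (d i + b i)%N.
rewrite (eq_bigr (fun Z : {set 'I_n} => mono (fun i => u i + 0)%N (fun i => v i + (i \in Z))%N));
  last by move=> Z _; rewrite monoM; apply: eq_mono => i; rewrite ?addnA ?addn0.
apply/eqP; apply: contraT => /[dup] pair_neq0 /pair_Delta_sum_neq0[Z [tau [Zr tauP]]].
have /card_gt0P[i0 i0Z] : (0 < #|Z|)%N by rewrite Zr.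
have tZ : tau ((tau^-1)%g i0) \in Z by rewrite permKV.
(* For y-exponents, which increase with the position, the first such p works with p - 1. *)
have [p pZ pmin] := arg_minnP (P := fun p => tau p \in Z) (fun p : 'I_n => p : nat) tZ.
have [xp yp] := tauP p; rewrite pZ in yp.
have lt_qn : (p.-1 < n)%N by have := ltn_ord p; lia.
pose q := Ordinal lt_qn; have [xq yq] := tauP q.
have qZ : tau q \notin Z by apply/negP => /pmin /=; lia.
rewrite (negPf qZ) /= in yq; rewrite /= in xq.
case/eqP: pair_neq0; apply: (@pair_Delta_sum_collision r u v _ _ (tau p) (tau q)).
- by rewrite (inj_eq perm_inj) -val_eqE /=; lia.
- lia.
- lia.
- by [].
- by move=> Y j; rewrite in_tperm_imset.
Qed.

End Annihilator.

(** * Sorting permutations and extremal subset sums *)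

Section Sorting.
Variable n : nat.
Implicit Types (f : 'I_n -> nat) (s pi : 'S_n) (S P T Z : {set 'I_n}).

(** The position of a letter is the number of letters with a smaller key. *)
Lemma sort_perm (key : 'I_n -> nat) : injective key ->
  exists pi : 'S_n, forall p q, (key (pi p) < key (pi q))%N = (p < q)%N.
Proof.
move=> key_inj; pose rk i := #|[set j | (key j < key i)%N]|.
have rk_lt i j : (key i < key j)%N -> (rk i < rk j)%N.
  move=> ij; apply: proper_card; apply/properP; split.
    by apply/subsetP => l; rewrite !inE => /ltn_trans->.
  by exists i; rewrite !inE ?ltnn.
have rkE i j : (rk i < rk j)%N = (key i < key j)%N.
  have [/rk_lt//|/rk_lt|/key_inj->] := ltngtP (key i) (key j); last by rewrite ltnn.
  lia.
have rk_bd i : (rk i < n)%N.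
  rewrite -[X in (_ < X)%N](card_ord n) -cardsT; apply: proper_card.
  by apply/properP; split; [exact: subsetT | exists i; rewrite !inE ?ltnn].
have rk_inj : injective (fun i => Ordinal (rk_bd i)).
  move=> i j /(congr1 val) /= eij; apply: key_inj.
  by have := rkE i j; have := rkE j i; rewrite eij ltnn; lia.
exists (perm rk_inj)^-1%g => p q; rewrite -rkE.
have rkK r : rk ((perm rk_inj)^-1%g r) = r.
  by rewrite -{2}[r](permKV (perm rk_inj)) permE.
by rewrite !rkK.
Qed.

(** An exact form of the exchange argument: P collects values at least c, and S outside P
    values at most c, so the excess of P over S splits into nonnegative contributions. *)
Lemma sum_threshold f S P c : #|S| = #|P| ->
  (forall i, i \in P -> (c <= f i)%N) ->
  (forall i, i \in S -> i \notin P -> (f i <= c)%N) ->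
  (\sum_(i in S) f i + (\sum_(i in P :\: S) (f i - c) + \sum_(i in S :\: P) (c - f i))
    = \sum_(i in P) f i)%N.
Proof.
move=> cSP fP fS; rewrite (big_setID P) /= [RHS](big_setID S) /= setIC -addnA; congr (_ + _)%N.
rewrite addnCA [RHS](eq_bigr (fun i => (f i - c) + c)%N); last first.
  by move=> i; rewrite inE => /andP[_ /fP]; lia.
rewrite big_split /=; congr (_ + _)%N; rewrite -big_split /=.
rewrite (eq_bigr (fun=> c)); last by move=> i; rewrite inE => /andP[iP iS]; have := fS _ iS iP; lia.
rewrite !sum_nat_const; congr (_ * _)%N.
by apply/eqP; move/eqP: cSP; rewrite -(cardsID P S) -(cardsID S P) setIC eqn_add2l.
Qed.

Lemma sum_threshold_le f S P c : #|S| = #|P| ->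
  (forall i, i \in P -> (c <= f i)%N) ->
  (forall i, i \in S -> i \notin P -> (f i <= c)%N) ->
  (\sum_(i in S) f i <= \sum_(i in P) f i)%N.
Proof. by move=> cSP fP fS; rewrite -(sum_threshold cSP fP fS) leq_addr. Qed.

Lemma sum_threshold_lt f S P c : #|S| = #|P| ->
  (forall i, i \in P -> (c <= f i)%N) ->
  (forall i, i \in S -> i \notin P -> (f i <= c)%N) ->
  (exists i, [&& i \in P, i \notin S & (c < f i)%N] || [&& i \in S, i \notin P & (f i < c)%N]) ->
  (\sum_(i in S) f i < \sum_(i in P) f i)%N.
Proof.
move=> cSP fP fS [i iP]; rewrite -(sum_threshold cSP fP fS) -[X in (X < _)%N]addn0 ltn_add2l.
case/orP: iP => /and3P[iP iS ci].
  by rewrite (bigD1 i) ?inE ?iP ?iS //=; lia.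
by rewrite [X in (_ + X)%N](bigD1 i) ?inE ?iP ?iS //=; lia.
Qed.

Lemma max_card_ord T : (#|T| <= n)%N.
Proof. by rewrite -[leqRHS]card_ord max_card. Qed.

Lemma sum_le_pfx f pi T : (forall p q : 'I_n, (p <= q)%N -> (f (pi q) <= f (pi p))%N) ->
  (\sum_(i in T) f i <= \sum_(i in pfx pi #|T|) f i)%N.
Proof.
move=> f_dec; have := max_card_ord T; move tE: #|T| => t le_tn.
have [t0|t_gt0] := posnP t; first by rewrite t0 in tE; rewrite (cards0_eq tE) big_set0.
have lt_tn : (t.-1 < n)%N by lia.
apply: (@sum_threshold_le _ _ _ (f (pi (Ordinal lt_tn)))); first by rewrite card_pfx.
  by move=> i; rewrite inE => ip; rewrite -[i](permKV pi); apply: f_dec => /=; lia.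
by move=> i _; rewrite inE => ip; rewrite -[i](permKV pi); apply: f_dec => /=; lia.
Qed.

Lemma sum_le_sfx f pi T : (forall p q : 'I_n, (p <= q)%N -> (f (pi p) <= f (pi q))%N) ->
  (\sum_(i in T) f i <= \sum_(i in ~: pfx pi (n - #|T|)) f i)%N.
Proof.
move=> f_inc; have := max_card_ord T; move tE: #|T| => t le_tn.
have [t0|t_gt0] := posnP t; first by rewrite t0 in tE; rewrite (cards0_eq tE) big_set0.
have lt_tn : (n - t < n)%N by lia.
apply: (@sum_threshold_le _ _ _ (f (pi (Ordinal lt_tn)))); first by rewrite card_pfxC ?tE; lia.
  by move=> i; rewrite !inE => ip; rewrite -[i](permKV pi); apply: f_inc => /=; lia.
by move=> i _; rewrite !inE => ip; rewrite -[i](permKV pi); apply: f_inc => /=; lia.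
Qed.

Lemma sum_indic T Z : (\sum_(i in T) (i \in Z) = #|T :&: Z|)%N.
Proof.
rewrite -sum1_card [RHS](eq_bigl (fun i => (i \in T) && (i \in Z))) ?big_mkcondr /=.
  by apply: eq_bigr => i _; case: (i \in Z).
by move=> i; rewrite inE.
Qed.

Lemma sum_mem Z : (\sum_i (i \in Z) = #|Z|)%N.
Proof. by rewrite -sum1_card [RHS]big_mkcond; apply: eq_bigr => i _; case: (i \in Z). Qed.

Lemma sum_add_indic_pfx f pi T Z :
  (forall p q : 'I_n, (p <= q)%N -> (f (pi q) <= f (pi p))%N) ->
  (\sum_(i in T) (f i + (i \in Z)) <=
     \sum_(i in pfx pi #|T|) (f i + (i \in pfx pi #|Z|)))%N.
Proof.
move=> f_dec; rewrite !big_split /= leq_add ?sum_le_pfx //= !sum_indic.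
have le_Tn : (#|T| <= n)%N by exact: max_card_ord.
have le_Zn : (#|Z| <= n)%N by exact: max_card_ord.
rewrite (_ : pfx _ _ :&: _ = pfx pi (minn #|T| #|Z|)).
  rewrite card_pfx ?geq_min ?le_Tn // leq_min.
  by rewrite !subset_leq_card ?subsetIl ?subsetIr.
by apply/setP => i; rewrite !inE leq_min.
Qed.

Lemma sum_add_indic_sfx f pi T Z :
  (forall p q : 'I_n, (p <= q)%N -> (f (pi p) <= f (pi q))%N) ->
  (\sum_(i in T) (f i + (i \in Z)) <=
     \sum_(i in ~: pfx pi (n - #|T|)) (f i + (i \in ~: pfx pi (n - #|Z|))))%N.
Proof.
move=> f_dec; rewrite !big_split /= leq_add ?sum_le_sfx //= !sum_indic.
have le_Tn : (#|T| <= n)%N by exact: max_card_ord.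
have le_Zn : (#|Z| <= n)%N by exact: max_card_ord.
rewrite (_ : ~: pfx _ _ :&: _ = ~: pfx pi (n - minn #|T| #|Z|)).
  rewrite card_pfxC ?leq_subr // subKn ?geq_min ?le_Tn // leq_min.
  by rewrite !subset_leq_card ?subsetIl ?subsetIr.
by apply/setP => i; rewrite !inE; move: #|T| #|Z| => t z; lia.
Qed.

End Sorting.

(** * Exponents of descent monomials *)

Section Descents.
Variables n k : nat.
Implicit Types (D : {set 'I_n}) (s pi tau : 'S_n).

(** [xexp D p] and [yexp D p] are the exponents d_(p+1) on the x-side and on the y-side, for a
    0-based position p; each vanishes on the other side of position k, so that no case
    distinction on p is needed. *)
Definition xexp D (p : nat) : nat := #|[set j in D | (p < j < k)%N]|.
Definition yexp D (p : nat) : nat := #|[set j in D | (k <= j <= p)%N]|.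

Lemma dmonE D pi :
  dmon k D pi = mono (fun i => xexp D ((pi^-1)%g i)) (fun i => yexp D ((pi^-1)%g i)).
Proof.
rewrite monoE /dmon; congr (_ * _); rewrite big_mkcond [RHS](reindex_inj (@perm_inj _ pi)) /=;
apply: eq_bigr => p _; rewrite permK /dexp; case: ifP => kp.
- by rewrite ltnW.
- rewrite /xexp (_ : [set _ in _ | _] = set0) ?cards0 //.
  by apply/setP => j; rewrite !inE; case: (j \in D) => //=; lia.
- by rewrite leqNgt kp.
- rewrite /yexp (_ : [set _ in _ | _] = set0) ?cards0 //.
  by apply/setP => j; rewrite !inE; case: (j \in D) => //=; lia.
Qed.

Lemma xexpS D (p q : 'I_n) : q = p.+1 :> nat -> (q < k)%N -> xexp D p = (xexp D q + (q \in D))%N.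
Proof.
move=> qp qk; rewrite /xexp (cardsD1 q) inE qp leqnn -qp qk !andbT addnC; congr (_ + _)%N.
apply: eq_card => j; rewrite !inE -val_eqE /= qp; case: (j \in D); rewrite ?andbF //=; lia.
Qed.

Lemma yexpS D (p q : 'I_n) : q = p.+1 :> nat -> (k <= q)%N -> yexp D q = (yexp D p + (q \in D))%N.
Proof.
move=> qp qk; rewrite /yexp (cardsD1 q) inE qk leqnn !andbT addnC; congr (_ + _)%N.
apply: eq_card => j; rewrite !inE -val_eqE /= qp; case: (j \in D); rewrite ?andbF //=; lia.
Qed.

Lemma xexp0 D p : (k.-1 <= p)%N -> xexp D p = 0%N.
Proof.
move=> kp; apply/eqP; rewrite cards_eq0; apply/eqP/setP => j; rewrite !inE.
by case: (j \in D) => //=; lia.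
Qed.

Lemma yexp0 D p : (p < k)%N -> yexp D p = 0%N.
Proof.
move=> kp; apply/eqP; rewrite cards_eq0; apply/eqP/setP => j; rewrite !inE.
by case: (j \in D) => //=; lia.
Qed.

Lemma xexp_dec D (p q : nat) : (p <= q)%N -> (xexp D q <= xexp D p)%N.
Proof.
move=> pq; apply/subset_leq_card/subsetP => j; rewrite !inE.
by case: (j \in D) => //=; lia.
Qed.

Lemma yexp_inc D (p q : nat) : (p <= q)%N -> (yexp D p <= yexp D q)%N.
Proof.
move=> pq; apply/subset_leq_card/subsetP => j; rewrite !inE.
by case: (j \in D) => //=; lia.
Qed.

Lemma DesP pi (p q : 'I_n) : q = p.+1 :> nat -> (q \in Des pi) = (pi q < pi p)%N.
Proof.
move=> qp; rewrite inE; apply/existsP/idP => [[r /andP[/eqP rq]]|lt_qp].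
  by have -> : r = p by apply/val_inj => /=; lia.
by exists p; rewrite qp eqxx.
Qed.

Lemma Des0 pi (q : 'I_n) : q = 0%N :> nat -> (q \in Des pi) = false.
Proof. by move=> q0; rewrite inE; apply/existsP => -[p]; rewrite q0. Qed.

End Descents.

(** * Spans and classes modulo J *)

Section SpanClosure.
Variables (V : lmodType rat) (X : V -> Prop).
Implicit Types u v : V.

Lemma lspan0 : 0 \in lspan X. Proof. exact: (lspan_submod X).1. Qed.
Lemma lspanD u v : u \in lspan X -> v \in lspan X -> u + v \in lspan X.
Proof. by rewrite -{2}[u]scale1r; exact: (lspan_submod X).2. Qed.
Lemma lspanZ q u : u \in lspan X -> q *: u \in lspan X.
Proof. by move=> Xu; rewrite -[_ *: _]addr0; apply: (lspan_submod X).2 => //; exact: lspan0. Qed.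
Lemma lspanN u : u \in lspan X -> - u \in lspan X.
Proof. by rewrite -scaleN1r; exact: lspanZ. Qed.
Lemma lspan_sum (I : Type) (r : seq I) (P : pred I) (F : I -> V) :
  (forall i, P i -> F i \in lspan X) -> \sum_(i <- r | P i) F i \in lspan X.
Proof.
by move=> XF; apply: (big_ind (fun v => v \in lspan X)) => //; [exact: lspan0 | exact: lspanD].
Qed.
Lemma lspan_gen u : X u -> u \in lspan X.
Proof.
move=> Xu; apply/lspanP; exists [:: (1, u)]; rewrite big_seq1 scale1r; split=> // p.
by rewrite inE => /eqP->.
Qed.
Lemma lspan_sub (Y : V -> Prop) u : (forall v, X v -> v \in lspan Y) ->
  u \in lspan X -> u \in lspan Y.
Proof.
move=> XY /lspanP[t [tX ->]]; rewrite big_seq.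
apply: (big_ind (fun v => v \in lspan Y)) => [|v w Yv Yw|p /tX/XY Yp].
- exact: (lspan_submod Y).1.
- by rewrite -[v]scale1r; apply: (lspan_submod Y).2.
- by rewrite -[_ *: _]addr0; apply: (lspan_submod Y).2 => //; exact: (lspan_submod Y).1.
Qed.

End SpanClosure.

Section Classes.
Variables n k : nat.

Lemma clJD : {morph @clJ n k : f g / f + g}.
Proof. exact: qclassD. Qed.
Lemma clJZ q f : @clJ n k (q *: f) = q *: clJ f.
Proof. exact: qclassZ. Qed.
Lemma clJ_eq0 f : (@clJ n k f == 0) = (f \in Jeta n k).
Proof.
have cl0 : @clJ n k 0 = 0 by rewrite -[0 in LHS](scale0r 0) clJZ scale0r.
by rewrite -cl0; apply/eqP/idP => [/qclassP|Jf]; [|apply/qclassP]; rewrite subr0.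
Qed.
Lemma clJ0 : @clJ n k 0 = 0.
Proof. by apply/eqP; rewrite clJ_eq0 rpred0. Qed.
Lemma clJ_sum (I : Type) (r : seq I) P (F : I -> polyxy n) :
  @clJ n k (\sum_(i <- r | P i) F i) = \sum_(i <- r | P i) clJ (F i).
Proof. by apply: (big_morph (@clJ n k)); [exact: clJD | exact: clJ0]. Qed.

(** A relation in J rewrites any one of its terms in terms of the others. *)
Lemma clJ_sum_D1 (I : finType) (P : pred I) (F : I -> polyxy n) i0 (X : Heta' n k -> Prop) :
  P i0 -> \sum_(i | P i) F i \in Jeta n k ->
  (forall i, P i -> i != i0 -> clJ (F i) \in lspan X) -> clJ (F i0) \in lspan X.
Proof.
move=> Pi0; rewrite -clJ_eq0 (bigD1 i0) //= clJD addr_eq0 => /eqP-> XF.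
by rewrite clJ_sum; apply/lspanN/lspan_sum => i /andP[Pi /XF->].
Qed.

End Classes.

(** * Straightening of monomials into descent monomials *)

Section Straightening.
Variables n k : nat.
Hypotheses (k_gt0 : (0 < k)%N) (le_kn : (k <= n)%N).
Implicit Types (a b c d : 'I_n -> nat) (s pi tau : 'S_n) (T Z : {set 'I_n}) (F G : nat -> nat).

(** When F gives the partial sums of a partition, this is dominance of the sorted
    exponents by that partition, without having to sort. *)
Definition sums_le F a := forall T, (\sum_(i in T) a i <= F #|T|)%N.

Definition amon_x pi (i : 'I_n) := xexp k (Des pi) ((pi^-1)%g i).
Definition amon_y pi (i : 'I_n) := yexp k (Des pi) ((pi^-1)%g i).

Definition straightened F G dx dy (v : Heta' n k) := exists2 pi,
  [/\ sums_le F (amon_x pi), sums_le G (amon_y pi), (\sum_i amon_x pi i = dx)%N & (\sum_i amon_y pi i = dy)%N]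
  & v = clJ (amon k pi).

(** Strictly convex in the exponents, so that it decreases when a layer moves away from the
    largest exponents; the linear terms break ties in favour of the order of the letters used
    to sort them, and n is large enough for them never to override the quadratic terms. *)
Definition weight a b := (\sum_i (n * a i ^ 2 + a i * (n - i) + n * b i ^ 2 + b i * i))%N.

(** Sorting by a - b, ties by increasing letters. As no letter carries both an x and a y, and
    the two supports are small, the x-exponents decrease before position k and the
    y-exponents increase after it. *)
Lemma sort_exponents a b : (forall i, a i = 0%N \/ b i = 0%N) ->
  (#|[set i | (0 < a i)%N]| < k)%N -> (#|[set i | (0 < b i)%N]| <= n - k)%N ->
  exists pi, [/\ forall p q : 'I_n, (p <= q)%N -> (a (pi q) <= a (pi p))%N /\ (b (pi p) <= b (pi q))%N,
    forall p q : 'I_n, (p <= q)%N -> a (pi q) = a (pi p) -> b (pi p) = b (pi q) ->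
       (pi p <= pi q)%N,
    forall p : 'I_n, (k.-1 <= p)%N -> a (pi p) = 0%N &
    forall p : 'I_n, (p < k)%N -> b (pi p) = 0%N].
Proof.
move=> ab sa sb; pose A := (\sum_i a i)%N.
have aA i : (a i <= A)%N by rewrite /A (bigD1 i) //= leq_addr.
(* Adding A keeps the subtraction from truncating; the factor n leaves room for the letter. *)
pose key (i : 'I_n) := ((A + b i - a i) * n + i)%N.
have keyE i j : (key i <= key j)%N = (A + b i - a i < A + b j - a j)%N
     || (A + b i - a i == A + b j - a j)%N && (i <= j)%N.
  rewrite /key; have := ltn_ord i; have := ltn_ord j.
  move: (A + b i - a i)%N (A + b j - a j)%N => u v jn i_n.
  have [uv|vu|->] := ltngtP u v; last by rewrite leq_add2l.
    have : (u.+1 * n <= v * n)%N by rewrite leq_mul2r uv orbT.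
    by rewrite mulSn; lia.
  have : (v.+1 * n <= u * n)%N by rewrite leq_mul2r vu orbT.
  by rewrite mulSn; lia.
have key_inj : injective key.
  move=> i j eij; apply/val_inj/eqP; rewrite eqn_leq /=.
  by have := keyE i j; have := keyE j i; rewrite eij leqnn; lia.
have [pi piP] := sort_perm key_inj; exists pi.
have piE (p q : 'I_n) : (p <= q)%N -> (A + b (pi p) - a (pi p) < A + b (pi q) - a (pi q))%N
     || (A + b (pi p) - a (pi p) == A + b (pi q) - a (pi q))%N && (pi p <= pi q)%N.
  by rewrite -keyE => pq; have := piP q p; lia.
have mon (p q : 'I_n) : (p <= q)%N -> (a (pi q) <= a (pi p))%N /\ (b (pi p) <= b (pi q))%N.
  move=> /piE; have := aA (pi p); have := aA (pi q).
  by have := ab (pi p); have := ab (pi q); lia.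
split=> //.
- by move=> p q /piE; lia.
- move=> p kp; apply/eqP; rewrite -leqn0 leqNgt; apply/negP => ap.
  have : (#|pfx pi p.+1| <= #|[set i | (0 < a i)%N]|)%N.
    apply/subset_leq_card/subsetP => i; rewrite !inE => ip.
    have [|] := mon ((pi^-1)%g i) p; first by lia.
    by rewrite permKV; lia.
  by rewrite card_pfx; [lia | exact: ltn_ord].
- move=> p kp; apply/eqP; rewrite -leqn0 leqNgt; apply/negP => ap.
  have : (#|~: pfx pi p| <= #|[set i | (0 < b i)%N]|)%N.
    apply/subset_leq_card/subsetP => i; rewrite !inE => ip.
    have [|_] := mon p ((pi^-1)%g i); first by lia.
    by rewrite permKV; lia.
  by rewrite card_pfxC; [lia | exact/ltnW].
Qed.

(** With f the exponents below the layer and h the tie-breaking linear weights, the layer P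
    is the unique maximum among the sets of its size, because its letters come first for the
    lexicographic order on (f, h). *)
Lemma sum_key_layer (f h : 'I_n -> nat) (P Z : {set 'I_n}) (i0 : 'I_n) :
  #|Z| = #|P| -> Z != P -> i0 \in P ->
  (forall i, (h i <= n)%N) ->
  (forall i, i \in P -> (f i0 < f i)%N \/ f i0 = f i /\ (h i0 <= h i)%N) ->
  (forall i, i \in Z -> i \notin P -> (f i < f i0)%N \/ f i = f i0 /\ (h i < h i0)%N) ->
  (\sum_i (n * (f i + (i \in Z)) ^ 2 + (f i + (i \in Z)) * h i) <
   \sum_i (n * (f i + (i \in P)) ^ 2 + (f i + (i \in P)) * h i))%N.
Proof.
move=> cZP neqZP i0P hn fP fZ.
have split_sum Y : (\sum_i (n * (f i + (i \in Y)) ^ 2 + (f i + (i \in Y)) * h i) =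
    \sum_i (n * f i ^ 2 + f i * h i) + \sum_(i in Y) (n * (2 * f i) + n + h i))%N.
  rewrite [X in (_ + X)%N]big_mkcond -big_split /=; apply: eq_bigr => i _.
  by case: (i \in Y); rewrite ?addn0 //= !mulnDr !mulnDl; nia.
rewrite !split_sum ltn_add2l.
have key i j : (f i < f j)%N \/ f i = f j /\ (h i < h j)%N ->
    (n * (2 * f i) + n + h i < n * (2 * f j) + n + h j)%N.
  case=> [fij|[-> hij]]; last by lia.
  have : (n * (2 * (f i).+1) <= n * (2 * f j))%N by rewrite leq_mul2l leq_mul2l fij !orbT.
  by have := hn i; have := hn j; have := ltn_ord i; lia.
apply: (@sum_threshold_lt _ _ _ _ (n * (2 * f i0) + n + h i0)) => // [i iP|i iZ iP|].
- case: (fP _ iP) => [ltf|[ef]]; first by apply/ltnW/key; left.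
  by rewrite ef leq_add2l.
- exact/ltnW/key/fZ.
have /subsetPn[i iZ iP] : ~~ (Z \subset P).
  by apply: contra neqZP => sZP; rewrite eqEcard sZP cZP /=.
by exists i; rewrite iZ iP (key _ _ (fZ _ iZ iP)) orbT.
Qed.

Lemma weightE a b :
  weight a b = (\sum_i (n * a i ^ 2 + a i * (n - i)) + \sum_i (n * b i ^ 2 + b i * i))%N.
Proof. by rewrite -big_split; apply: eq_bigr => i _ /=; rewrite addnA. Qed.

Lemma amonE pi : amon k pi = mono (amon_x pi) (amon_y pi).
Proof. by rewrite /amon dmonE. Qed.

(** The exponents are determined by their last value and by their drops. *)
Lemma xexp_charac (D : {set 'I_n}) (al : 'I_n -> nat) :
  (forall p : 'I_n, (k.-1 <= p)%N -> al p = 0%N) ->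
  (forall p q : 'I_n, q = p.+1 :> nat -> (q < k)%N -> al p = al q + (q \in D))%N ->
  forall p, al p = xexp k D p.
Proof.
move=> al0 alS p; have [m le_m] := ubnP (k - p).
elim: m => // m IHm in p le_m *.
have [kp|pk] := leqP k.-1 p; first by rewrite al0 ?xexp0.
have lt_q : (p.+1 < n)%N by lia.
have qk : (Ordinal lt_q < k)%N by rewrite /=; lia.
by rewrite (@xexpS _ _ _ p (Ordinal lt_q)) // (alS _ (Ordinal lt_q)) // IHm //=; lia.
Qed.

Lemma yexp_charac (D : {set 'I_n}) (be : 'I_n -> nat) :
  (forall p : 'I_n, (p < k)%N -> be p = 0%N) ->
  (forall p q : 'I_n, q = p.+1 :> nat -> (k <= q)%N -> be q = be p + (q \in D))%N ->
  forall p, be p = yexp k D p.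
Proof.
move=> be0 beS [p lt_pn]; elim: p lt_pn => [|p IHp] lt_pn; first by rewrite be0 ?yexp0.
have [kp|pk] := leqP k p.+1; last by rewrite be0 ?yexp0.
rewrite (@yexpS _ _ _ (Ordinal (ltnW lt_pn)) (Ordinal lt_pn)) //.
by rewrite (beS (Ordinal (ltnW lt_pn))) // IHp.
Qed.

(** Let pi sort the exponents. They drop by at least one at each descent of pi; if they drop
    by exactly one there and nowhere else, the monomial is a descent monomial. Otherwise
    some drop is too large: the layer formed by the letters before it (after it, for y) can be
    separated, and multiplying the remaining monomial by an elementary symmetric polynomial
    expresses the monomial, modulo J, by the same monomial with the layer moved to another
    set. This lowers [weight] and increases no maximal subset sum. *)
Lemma straighten F G dx dy a b :
  sums_le F a -> sums_le G b -> (\sum_i a i = dx)%N -> (\sum_i b i = dy)%N ->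
  clJ (mono a b) \in lspan (straightened F G dx dy).
Proof.
have [w] := ubnP (weight a b); elim: w => // w IHw in a b *.
rewrite ltnS => le_w Fa Gb sa sb.
have memJ c d : mono c d \in Jeta n k -> clJ (mono c d) \in lspan (straightened F G dx dy).
  by rewrite -clJ_eq0 => /eqP->; exact: lspan0.
have [/existsP[i /andP[ai bi]]|/existsPn ab] := boolP [exists i, (0 < a i)%N && (0 < b i)%N].
  exact/memJ/(@xy_Jeta _ _ k_gt0 le_kn _ _ i).
have [ka|ka] := leqP k #|[set i | (0 < a i)%N]|; first exact/memJ/xsupp_Jeta.
have [kb|kb] := ltnP (n - k) #|[set i | (0 < b i)%N]|; first exact/memJ/ysupp_Jeta.
have [|pi [mon tie a0 b0]] := @sort_exponents a b _ ka kb.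
  by move=> i; have := ab i; lia.
have drop (p q : 'I_n) : q = p.+1 :> nat ->
    (a (pi q) + ((q < k) && (q \in Des pi)) <= a (pi p))%N
    /\ (b (pi p) + ((k <= q) && (q \in Des pi)) <= b (pi q))%N.
  move=> qp; have pq : (p <= q)%N by lia.
  have [apq bpq] := mon p q pq.
  case Dq: (q \in Des pi); last by rewrite !andbF !addn0.
  rewrite !andbT; move: Dq; rewrite (DesP _ qp) => Dq.
  have := tie p q pq; case: ltnP => qk.
    by rewrite (b0 q) ?(b0 p) //; lia.
  by rewrite (a0 q) ?(a0 p) //; lia.
(* Either some drop exceeds what the descents of pi require, or every drop is exact. *)
have [/existsP[p /existsP[q /andP[/eqP qp]]]|/existsPn noexc] := boolP [exists p : 'I_n,
  [exists q : 'I_n, (q == p.+1 :> nat) && (if (q < k)%N then (a (pi q) + (q \in Des pi) < a (pi p))%N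
     else (b (pi p) + (q \in Des pi) < b (pi q))%N)]]; last first.
  have aE i : a i = amon_x pi i.
    rewrite /amon_x -(@xexp_charac _ (fun p => a (pi p))) ?permKV // => p q qp qk.
    by have /existsPn/(_ q) := noexc p; have [] := drop p q qp; rewrite qp eqxx -qp qk; case: (q \in _) => /=; lia.
  have bE i : b i = amon_y pi i.
    rewrite /amon_y -(@yexp_charac _ (fun p => b (pi p))) ?permKV // => p q qp qk.
    by have /existsPn/(_ q) := noexc p; have [] := drop p q qp; rewrite qp eqxx -qp ltnNge qk; case: (q \in _) => /=; lia.
  apply: lspan_gen; exists pi; last by rewrite amonE; congr clJ; exact: eq_mono.
  rewrite -sa -sb; split=> [T|T||]; rewrite ?(eq_bigr _ (fun i _ => esym (aE i))) //;
  by rewrite ?(eq_bigr _ (fun i _ => esym (bE i))) //.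
have lt_pn := ltn_ord p; have lt_qn := ltn_ord q.
case: ifP => qk exc.
  (* The layer P lies before the large drop; c is what remains, still sorted by pi. *)
  pose P := pfx pi q; pose c i := (a i - (i \in P))%N.
  have cE i : a i = (c i + (i \in P))%N.
    rewrite /c subnK //; case iP: (i \in P) => //.
    have [|+ _] := mon ((pi^-1)%g i) p; first by move: iP; rewrite inE; lia.
    by rewrite permKV; lia.
  have cP : #|P| = q by rewrite card_pfx // ltnW.
  have q_gt0 : (0 < q)%N by lia.
  have cpi r : (c (pi r) = a (pi r) - (r < q))%N by rewrite /c inE permK.
  have c_dec (r r' : 'I_n) : (r <= r')%N -> (c (pi r') <= c (pi r))%N.
    move=> rr'; rewrite !cpi; have [arr' _] := mon _ _ rr'.
    have [rq|qr] := ltnP r q; have [r'q|qr'] := ltnP r' q; try lia.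
    have [|arp _] := mon r p; first by lia.
    by have [|aqr' _] := mon q r'; lia.
  have := @esymx_Jeta n k k_gt0 le_kn c b q q_gt0.
  rewrite (_ : mono a b = mono (fun i => c i + (i \in P))%N b); last exact: eq_mono.
  move=> sumJ; apply: (clJ_sum_D1 (i0 := P) _ sumJ); first by rewrite cP.
  move=> Z /eqP cZ ZP.
  have [/existsP[i /andP[iZ bi]]|/existsPn Zb] := boolP [exists i, (i \in Z) && (0 < b i)%N].
    by apply/memJ/(@xy_Jeta _ _ k_gt0 le_kn _ _ i) => //; rewrite iZ addn1.
  apply: IHw => // [|T|].
  - apply: leq_trans _ le_w; rewrite !weightE ltn_add2r.
    rewrite [X in (_ < X)%N](eq_bigr (fun i : 'I_n => n * (c i + (i \in P)) ^ 2
          + (c i + (i \in P)) * (n - i))%N); last by move=> i _; rewrite -cE.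
    apply: (@sum_key_layer c (fun i : 'I_n => n - i)%N P Z (pi p)) => //.
    + by rewrite cP.
    + by rewrite inE permK qp.
    + by move=> i; rewrite leq_subr.
    + move=> i; rewrite -[i](permKV pi); move: ((pi^-1)%g i) => r.
      rewrite inE permK => rq; have rp : (r <= p)%N by lia.
      have := c_dec _ _ rp; have := tie _ _ rp; rewrite (b0 r) ?(b0 p); [|lia..].
      by rewrite !cpi; have [] := mon _ _ rp; lia.
    + move=> i; rewrite -[i](permKV pi); move: ((pi^-1)%g i) => r iZ.
      rewrite inE permK -leqNgt => qr; have := Zb (pi r); rewrite iZ /= -leqNgt leqn0 => /eqP br.
      have := ltn_ord (pi p); have := mon _ _ qr; have := tie _ _ qr.
      move: exc; rewrite br (b0 q qk) (DesP _ qp) !cpi qp ltnSn.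
      have : pi p != pi q :> nat by rewrite (inj_eq val_inj) (inj_eq perm_inj) -val_eqE /=; lia.
      by case: (ltngtP (pi q) (pi p)) => //=; lia.
  - have := Fa (pfx pi #|T|); rewrite card_pfx ?max_card_ord //; apply: leq_trans.
    apply: leq_trans (sum_add_indic_pfx T Z c_dec) _.
    by rewrite cZ; apply: leq_sum => i _; rewrite cE.
  - rewrite big_split /= -sa [RHS](eq_bigr _ (fun i _ => cE i)) big_split /=; congr (_ + _)%N.
    by rewrite !sum_mem cZ cP.
have kq : (k <= q)%N by rewrite leqNgt qk.
pose P := ~: pfx pi q; pose c i := (b i - (i \in P))%N.
have cE i : b i = (c i + (i \in P))%N.
  rewrite /c subnK //; case iP: (i \in P) => //.
  have [|_ +] := mon q ((pi^-1)%g i); first by move: iP; rewrite !inE; lia.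
  by rewrite permKV; lia.
have cP : #|P| = (n - q)%N by rewrite card_pfxC // ltnW.
have q_gt0 : (0 < n - q)%N by lia.
have cpi r : c (pi r) = (b (pi r) - (q <= r))%N by rewrite /c !inE permK -leqNgt.
have c_inc (r r' : 'I_n) : (r <= r')%N -> (c (pi r) <= c (pi r'))%N.
  move=> rr'; rewrite !cpi; have [_ brr'] := mon _ _ rr'.
  have [rq|qr] := leqP q r; have [r'q|qr'] := leqP q r'; try lia.
  have [|_ bqr'] := mon q r'; first by lia.
  by have [|_ brp] := mon r p; lia.
have := @esymy_Jeta n k k_gt0 le_kn a c (n - q) q_gt0.
rewrite (_ : mono a b = mono a (fun i => c i + (i \in P))%N); last exact: eq_mono.
move=> sumJ; apply: (clJ_sum_D1 (i0 := P) _ sumJ); first by rewrite cP.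
move=> Z /eqP cZ ZP.
have [/existsP[i /andP[iZ ai]]|/existsPn Za] := boolP [exists i, (i \in Z) && (0 < a i)%N].
  by apply/memJ/(@xy_Jeta _ _ k_gt0 le_kn _ _ i) => //; rewrite iZ addn1.
apply: IHw => // [|T|].
- apply: leq_trans _ le_w; rewrite !weightE ltn_add2l.
  rewrite [X in (_ < X)%N](eq_bigr (fun i : 'I_n => n * (c i + (i \in P)) ^ 2
        + (c i + (i \in P)) * i)%N); last by move=> i _; rewrite -cE.
  apply: (@sum_key_layer c (fun i : 'I_n => i) P Z (pi q)) => //.
  + by rewrite cP.
  + by rewrite !inE permK ltnn.
  + by move=> i; rewrite ltnW.
  + move=> i; rewrite -[i](permKV pi); move: ((pi^-1)%g i) => r.
    rewrite !inE permK -leqNgt => qr.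
    have := c_inc _ _ qr; have := tie _ _ qr; rewrite (a0 r) ?(a0 q); [|lia..].
    by rewrite !cpi; have [] := mon _ _ qr; lia.
  + move=> i; rewrite -[i](permKV pi); move: ((pi^-1)%g i) => r iZ.
    rewrite !inE permK negbK => rq; have := Za (pi r); rewrite iZ /= -leqNgt leqn0 => /eqP ar.
    have rp : (r <= p)%N by lia.
    have := mon _ _ rp; have := tie _ _ rp.
    move: exc; rewrite ar (a0 p) ?(DesP _ qp) ?cpi ?leqnn; last by lia.
    have : pi p != pi q :> nat by rewrite (inj_eq val_inj) (inj_eq perm_inj) -val_eqE /=; lia.
    by case: (ltngtP (pi q) (pi p)) => //=; lia.
- have := Gb (~: pfx pi (n - #|T|)); rewrite card_pfxC ?leq_subr // subKn ?max_card_ord //.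
  apply: leq_trans.
  apply: leq_trans (sum_add_indic_sfx T Z c_inc) _.
  rewrite cZ subKn; last exact: ltnW.
  by apply: leq_sum => i _; rewrite cE.
- rewrite big_split /= -sb [RHS](eq_bigr _ (fun i _ => cE i)) big_split /=; congr (_ + _)%N.
  by rewrite !sum_mem cZ cP.
Qed.

End Straightening.

(** * Lexicographic order on words with given descents *)

Section Words.
Variable n : nat.
Implicit Types (pi tau : 'S_n) (m p q : 'I_n).

Definition word pi : n.-tuplelexi nat := [tuple pi p : nat | p < n].

Lemma pfx_mem pi (m : nat) p : (pi p \in pfx pi m) = (p < m)%N.
Proof. by rewrite inE permK. Qed.

Lemma run_increasing pi p q : (p < q)%N ->
  (forall m, (p < m <= q)%N -> m \notin Des pi) -> (pi p < pi q)%N.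
Proof.
case: q => q; elim: q => //= q IHq lt_qn pq noDes.
have := noDes (Ordinal lt_qn); rewrite (@DesP _ _ (Ordinal (ltnW lt_qn))) //= pq leqnn => /(_ isT).
rewrite -leqNgt leq_eqVlt (inj_eq val_inj) (inj_eq perm_inj) -val_eqE /= ltn_eqF //= => le_q.
have [e|pq'] := eqVneq (p : nat) q.
  by have -> : p = Ordinal (ltnW lt_qn) by apply/val_inj.
apply: ltn_trans le_q; apply: IHq => [|m /andP[pm mq]]; first by rewrite ltn_neqAle pq'.
by apply: noDes; rewrite pm ltnW.
Qed.

Lemma run_decreasing pi p q : (p < q)%N ->
  (forall m, (p < m <= q)%N -> m \in Des pi) -> (pi q < pi p)%N.
Proof.
case: q => q; elim: q => //= q IHq lt_qn pq allDes.
have := allDes (Ordinal lt_qn); rewrite (@DesP _ _ (Ordinal (ltnW lt_qn))) //= pq leqnn => /(_ isT) le_q.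
have [e|pq'] := eqVneq (p : nat) q.
  by have -> : p = Ordinal (ltnW lt_qn) by apply/val_inj.
apply: ltn_trans le_q _; apply: IHq => [|m /andP[pm mq]]; first by rewrite ltn_neqAle pq'.
by apply: allDes; rewrite pm ltnW.
Qed.

Lemma first_diff pi tau : pi != tau -> exists p q,
  [/\ forall r : 'I_n, (r < p)%N -> pi r = tau r, (p < q)%N & tau p = pi q].
Proof.
move=> neq; have [p0 neq0] : exists p, pi p != tau p.
  by apply/existsP; rewrite -negb_forall; apply: contra neq => /forallP e; apply/eqP/permP => p; apply/eqP.
have [p neqp pmin] := arg_minnP (P := fun p => pi p != tau p) (fun p : 'I_n => p : nat) neq0.
have e (r : 'I_n) : (r < p)%N -> pi r = tau r.
  by move=> rp; apply/eqP; apply: contraLR rp => /pmin; rewrite -leqNgt.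
exists p, ((pi^-1)%g (tau p)); split=> //; last by rewrite permKV.
set q := (pi^-1)%g _; have piq : pi q = tau p by rewrite permKV.
rewrite ltn_neqAle leqNgt; apply/andP; split; last first.
  by apply/negP => /[dup] qp /e; rewrite piq => /perm_inj pq; rewrite pq ltnn in qp.
by apply: contra neqp => /eqP/ord_inj pq; rewrite {1}pq piq.
Qed.

Lemma word_lt pi tau p : (forall r : 'I_n, (r < p)%N -> pi r = tau r) -> (pi p < tau p)%N ->
  (word pi <= word tau)%O.
Proof.
move=> e lt_p; apply/Order.POrderTheory.ltW/Order.TupleLexiOrder.Exports.ltxi_tuplePlt; exists p.
  by move=> r rp; rewrite !tnth_mktuple e.
by rewrite !tnth_mktuple.
Qed.

(** If the prefixes agree at every descent of pi, then pi is tau with each block between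
    consecutive descents sorted increasingly: at the first difference the letter of tau occurs
    later in pi, within the same increasing block. *)
Lemma word_le_asc pi tau :
  (forall m, m \in Des pi -> pfx tau m = pfx pi m) -> (word pi <= word tau)%O.
Proof.
move=> pfxE; have [->//|/first_diff[p [q [e pq eq]]]] := eqVneq pi tau.
apply: (word_lt e); rewrite eq; apply: run_increasing pq _ => m /andP[pm mq].
by apply/negP => /pfxE/setP/(_ (tau p)); rewrite pfx_mem pm eq pfx_mem ltnNge mq.
Qed.

Lemma word_le_desc pi tau :
  (forall m, (0 < m)%N -> m \notin Des pi -> pfx tau m = pfx pi m) -> (word tau <= word pi)%O.
Proof.
move=> pfxE; have [->//|/first_diff[p [q [e pq eq]]]] := eqVneq pi tau.
apply: (@word_lt _ _ p) => [r /e//|]; rewrite eq; apply: run_decreasing pq _ => m /andP[pm mq].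
apply: contraT => /(pfxE _ (leq_ltn_trans (leq0n p) pm))/setP/(_ (tau p)).
by rewrite pfx_mem pm eq pfx_mem ltnNge mq.
Qed.

Lemma word_inj : injective word.
Proof.
move=> pi tau e; apply/permP => p; apply/val_inj.
by rewrite /= -[LHS](tnth_mktuple (fun p => pi p : nat)) -[RHS](tnth_mktuple (fun p => tau p : nat)) -/(word _) e.
Qed.

End Words.

(** * Linear independence of the descent monomials *)

Section Independence.
Variables n k : nat.
Hypotheses (k_gt0 : (0 < k)%N) (le_kn : (k <= n)%N).
Implicit Types (D E : {set 'I_n}) (s pi sg tau : 'S_n) (T Z : {set 'I_n}).

Lemma xexp_setC D p : (xexp k D p + xexp k (~: D) p)%N = xexp k [set: 'I_n] p.
Proof.
rewrite /xexp -[RHS](cardsID D); congr (_ + _)%N; apply: eq_card => j; rewrite !inE.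
  by case: (j \in D); rewrite ?andbT ?andbF.
by case: (j \in D); rewrite ?andbT ?andbF.
Qed.

Lemma yexp_setC D p : (yexp k D p + yexp k (~: D) p)%N = yexp k [set: 'I_n] p.
Proof.
rewrite /yexp -[RHS](cardsID D); congr (_ + _)%N; apply: eq_card => j; rewrite !inE.
  by case: (j \in D); rewrite ?andbT ?andbF.
by case: (j \in D); rewrite ?andbT ?andbF.
Qed.

Lemma xexp_setT (p : 'I_n) : xexp k [set: 'I_n] p = (k.-1 - p)%N.
Proof.
rewrite -(@xexp_charac n k k_gt0 le_kn [set: 'I_n] (fun p => k.-1 - p)%N) //= => [r|r q]; first by lia.
by rewrite inE; lia.
Qed.

Lemma yexp_setT (p : 'I_n) : yexp k [set: 'I_n] p = (p.+1 - k)%N.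
Proof.
rewrite -(@yexp_charac n k k_gt0 [set: 'I_n] (fun p => p.+1 - k)%N) //= => [r|r q]; first by lia.
by rewrite inE; lia.
Qed.

Lemma sum_pfx (f : 'I_n -> nat) pi m :
  (\sum_(i in pfx pi m) f ((pi^-1)%g i) = \sum_(p < n | p < m) f p)%N.
Proof.
rewrite (reindex_inj (@perm_inj _ pi)) /=; apply: eq_big => [p|p _]; last by rewrite permK.
by rewrite inE permK.
Qed.

Lemma sum_sfx (f : 'I_n -> nat) pi m :
  (\sum_(i in ~: pfx pi m) f ((pi^-1)%g i) = \sum_(p < n | m <= p) f p)%N.
Proof.
rewrite (reindex_inj (@perm_inj _ pi)) /=; apply: eq_big => [p|p _]; last by rewrite permK.
by rewrite !inE permK -leqNgt.
Qed.

Definition xsum D m := (\sum_(p < n | p < m) xexp k D p)%N.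
Definition ysum D m := (\sum_(p < n | m <= p) yexp k D p)%N.

Lemma sum_xexp_le D pi T :
  (\sum_(i in T) xexp k D ((pi^-1)%g i) <= xsum D #|T|)%N.
Proof.
rewrite /xsum -(sum_pfx (fun p : 'I_n => xexp k D p) pi).
by apply: sum_le_pfx => p q pq; rewrite !permK xexp_dec.
Qed.

Lemma sum_yexp_le D pi T :
  (\sum_(i in T) yexp k D ((pi^-1)%g i) <= ysum D (n - #|T|))%N.
Proof.
rewrite /ysum -(sum_sfx (fun p : 'I_n => yexp k D p) pi).
by apply: sum_le_sfx => p q pq; rewrite !permK yexp_inc.
Qed.

(** The exponents drop strictly at a descent, so that the largest subset sum of that size is
    attained only once. *)
Lemma sum_xexp_tight D pi (m : 'I_n) T : m \in D -> (0 < m < k)%N -> #|T| = m ->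
  (\sum_(i in T) xexp k D ((pi^-1)%g i) = xsum D m)%N -> T = pfx pi m.
Proof.
move=> mD /andP[m_gt0 mk] cT sT; apply/eqP; apply: contraT => neqT.
have lt_p : (m.-1 < n)%N by have := ltn_ord m; lia.
have mE : m = (Ordinal lt_p).+1 :> nat by rewrite /= prednK.
have cTP : #|T| = #|pfx pi m| by rewrite card_pfx // ltnW.
have exm := @xexpS n k D _ _ mE mk; rewrite mD /= in exm.
suff : (\sum_(i in T) xexp k D ((pi^-1)%g i) < \sum_(i in pfx pi m) xexp k D ((pi^-1)%g i))%N.
  by rewrite (sum_pfx (fun p : 'I_n => xexp k D p)) sT ltnn.
apply: (@sum_threshold_lt _ _ _ _ (xexp k D m.-1)) => // [i|i _|].
- by rewrite inE => im; apply: xexp_dec; lia.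
- by rewrite inE => im; apply: xexp_dec; lia.
have /subsetPn[i iT iP] : ~~ (T \subset pfx pi m).
  by apply: contra neqT => sTP; rewrite eqEcard sTP cTP /=.
exists i; rewrite iT iP /= exm andbF /= addn1 ltnS xexp_dec //.
by move: iP; rewrite inE -leqNgt.
Qed.

Lemma sum_yexp_tight D pi (m : 'I_n) T : m \in D -> (k <= m)%N -> #|T| = (n - m)%N ->
  (\sum_(i in T) yexp k D ((pi^-1)%g i) = ysum D m)%N -> T = ~: pfx pi m.
Proof.
move=> mD mk cT sT; apply/eqP; apply: contraT => neqT.
have lt_p : (m.-1 < n)%N by have := ltn_ord m; lia.
have mE : m = (Ordinal lt_p).+1 :> nat by rewrite /= prednK //; lia.
have cTP : #|T| = #|~: pfx pi m| by rewrite card_pfxC // ltnW.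
have eym := @yexpS n k D _ _ mE mk; rewrite mD /= in eym.
suff : (\sum_(i in T) yexp k D ((pi^-1)%g i) < \sum_(i in ~: pfx pi m) yexp k D ((pi^-1)%g i))%N.
  by rewrite (sum_sfx (fun p : 'I_n => yexp k D p)) sT ltnn.
apply: (@sum_threshold_lt _ _ _ _ (yexp k D m)) => // [i|i _|].
- by rewrite !inE => im; apply: yexp_inc; lia.
- by rewrite !inE => im; apply: yexp_inc; lia.
have /subsetPn[i iT iP] : ~~ (T \subset ~: pfx pi m).
  by apply: contra neqT => sTP; rewrite eqEcard sTP cTP /=.
exists i; rewrite iT iP /= eym andbF /= addn1 ltnS yexp_inc //.
by move: iP; rewrite !inE negbK; lia.
Qed.

(** The complementary monomial, with layers at the ascents: its product with the descent
    monomial of pi has a layer at every position, hence is a monomial of Delta. *)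
Definition dual_mon pi := dmon k (~: Des pi) pi.

Lemma amon_dual_mon pi sg : amon k pi * dual_mon sg =
  mono (fun i => xexp k (Des pi) ((pi^-1)%g i) + xexp k (~: Des sg) ((sg^-1)%g i))%N
       (fun i => yexp k (Des pi) ((pi^-1)%g i) + yexp k (~: Des sg) ((sg^-1)%g i))%N.
Proof. by rewrite /amon /dual_mon !dmonE monoM. Qed.

Lemma pair_Delta_amon_dual_diag pi : pair_Delta k (amon k pi * dual_mon pi) != 0.
Proof.
rewrite amon_dual_mon; move: (pair_Delta_top k_gt0 le_kn pi); congr (pair_Delta k _ != 0).
by apply: eq_mono => i; rewrite ?xexp_setC ?yexp_setC ?xexp_setT ?yexp_setT.
Qed.

(** Strictly monotone for dominance, as a sum of all partial sums. *)
Definition totsum D := (\sum_(m < n.+1) (xsum D m + ysum D m))%N.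

(** Triangularity. A nonzero pairing means that the product is the monomial of Delta
    arranged by some tau. Comparing partial sums along tau shows that the exponents of pi
    dominate those of sg. In case of equality pi and sg have the same descents and all the
    comparisons are tight, so that tau has the prefixes of pi at descents and those of sg at
    ascents: pi sorts the blocks of tau increasingly and sg sorts its descending runs
    decreasingly. *)
Lemma pair_Delta_amon_dual pi sg : pair_Delta k (amon k pi * dual_mon sg) != 0 ->
  (totsum (Des sg) <= totsum (Des pi))%N /\
  (totsum (Des sg) = totsum (Des pi) -> (word pi <= word sg)%O).
Proof.
rewrite amon_dual_mon => /(pair_Delta_mono_neq0 k_gt0 le_kn)[tau tauP].
set D := Des pi in tauP *; set E := Des sg in tauP *.
have sumX m : (m <= n)%N -> (\sum_(i in pfx tau m) xexp k D ((pi^-1)%g i) +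
    \sum_(i in pfx tau m) xexp k (~: E) ((sg^-1)%g i) = xsum E m + xsum (~: E) m)%N.
  move=> mn; rewrite /xsum -!big_split /=.
  rewrite (reindex_inj (@perm_inj _ tau)) /=; apply: eq_big => [p|p _]; first by rewrite inE permK.
  by case: (tauP p) => -> _; rewrite xexp_setC xexp_setT.
have sumY m : (m <= n)%N -> (\sum_(i in ~: pfx tau m) yexp k D ((pi^-1)%g i) +
    \sum_(i in ~: pfx tau m) yexp k (~: E) ((sg^-1)%g i) = ysum E m + ysum (~: E) m)%N.
  move=> mn; rewrite /ysum -!big_split /=.
  rewrite (reindex_inj (@perm_inj _ tau)) /=.
  apply: eq_big => [p|p _]; first by rewrite !inE permK -leqNgt.
  by case: (tauP p) => _ ->; rewrite yexp_setC yexp_setT.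
have xle1 m : (m <= n)%N -> (\sum_(i in pfx tau m) xexp k D ((pi^-1)%g i) <= xsum D m)%N.
  by move=> mn; rewrite -{2}(card_pfx tau mn) sum_xexp_le.
have xle2 m : (m <= n)%N -> (\sum_(i in pfx tau m) xexp k (~: E) ((sg^-1)%g i) <= xsum (~: E) m)%N.
  by move=> mn; rewrite -{2}(card_pfx tau mn) sum_xexp_le.
have yle1 m : (m <= n)%N -> (\sum_(i in ~: pfx tau m) yexp k D ((pi^-1)%g i) <= ysum D m)%N.
  by move=> mn; apply: leq_trans (sum_yexp_le _ _ _) _; rewrite card_pfxC // subKn.
have yle2 m : (m <= n)%N ->
    (\sum_(i in ~: pfx tau m) yexp k (~: E) ((sg^-1)%g i) <= ysum (~: E) m)%N.
  by move=> mn; apply: leq_trans (sum_yexp_le _ _ _) _; rewrite card_pfxC // subKn.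
have xle m : (m <= n)%N -> (xsum E m <= xsum D m)%N.
  by move=> mn; have := sumX _ mn; have := xle1 _ mn; have := xle2 _ mn; lia.
have yle m : (m <= n)%N -> (ysum E m <= ysum D m)%N.
  by move=> mn; have := sumY _ mn; have := yle1 _ mn; have := yle2 _ mn; lia.
have xyle (m : 'I_n.+1) : (xsum E m + ysum E m <= xsum D m + ysum D m)%N.
  by rewrite leq_add ?xle ?yle // -ltnS.
split=> [|tot]; first exact: leq_sum.
have xyE (m : 'I_n.+1) : (xsum E m + ysum E m = xsum D m + ysum D m)%N.
  apply/eqP; rewrite eqn_leq xyle /=.
  move/eqP: tot; rewrite eqn_leq => /andP[_]; rewrite /totsum (bigD1 m) // [leqRHS](bigD1 m) //=.
  have : (\sum_(i < n.+1 | i != m) (xsum E i + ysum E i)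
          <= \sum_(i < n.+1 | i != m) (xsum D i + ysum D i))%N by apply: leq_sum.
  by move=> le_s /leq_trans/(_ (leq_add (leqnn _) le_s)); rewrite leq_add2r.
have xE m : (m <= n)%N -> xsum E m = xsum D m.
  move=> mn; have := xyE (Ordinal (_ : m < n.+1)%N) => /(_ mn) /=.
  by have := xle _ mn; have := yle _ mn; lia.
have yE m : (m <= n)%N -> ysum E m = ysum D m.
  move=> mn; have := xyE (Ordinal (_ : m < n.+1)%N) => /(_ mn) /=.
  by have := xle _ mn; have := yle _ mn; lia.
have xsumS C (p : 'I_n) : xsum C p.+1 = (xsum C p + xexp k C p)%N.
  rewrite /xsum (bigD1 p) //= addnC; congr (_ + _)%N; apply: eq_bigl => q.
  by rewrite -val_eqE /=; lia.
have ysumS C (p : 'I_n) : ysum C p = (ysum C p.+1 + yexp k C p)%N.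
  rewrite /ysum (bigD1 p) //= addnC; congr (_ + _)%N; apply: eq_bigl => q.
  by rewrite -val_eqE /=; lia.
have exE (p : 'I_n) : xexp k E p = xexp k D p.
  have := xsumS E p; have := xsumS D p; rewrite !xE ?ltn_ord //; last exact: ltnW.
  lia.
have eyE (p : 'I_n) : yexp k E p = yexp k D p.
  have := ysumS E p; have := ysumS D p; rewrite !yE ?ltn_ord //; last exact: ltnW.
  lia.
(* Equal exponents give equal descent sets; from here on the comparisons are tight. *)
have ED : E = D.
  apply/setP => q; have [q0|q_gt0] := posnP q; first by rewrite /E /D !Des0.
  have lt_p : (q.-1 < n)%N by have := ltn_ord q; lia.
  have qE : q = (Ordinal lt_p).+1 :> nat by rewrite /= prednK.
  have [kq|qk] := leqP k q.
    have := @yexpS n k D _ _ qE kq; have := @yexpS n k E _ _ qE kq; rewrite !eyE.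
    by do 2!case: (q \in _); lia.
  have := @xexpS n k D _ _ qE qk; have := @xexpS n k E _ _ qE qk; rewrite !exE.
  by do 2!case: (q \in _); lia.
have cpfx (m : 'I_n) : #|pfx tau m| = m by rewrite card_pfx // ltnW.
have cpfxC (m : 'I_n) : #|~: pfx tau m| = (n - m)%N by rewrite card_pfxC // ltnW.
have xtight1 m : (m <= n)%N ->
    (\sum_(i in pfx tau m) xexp k D ((pi^-1)%g i) = xsum D m)%N.
  by move=> mn; have := sumX _ mn; have := xle1 _ mn; have := xle2 _ mn; rewrite xE //; lia.
have xtight2 m : (m <= n)%N ->
    (\sum_(i in pfx tau m) xexp k (~: E) ((sg^-1)%g i) = xsum (~: E) m)%N.
  by move=> mn; have := sumX _ mn; have := xle1 _ mn; have := xle2 _ mn; rewrite xE //; lia.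
have ytight1 m : (m <= n)%N ->
    (\sum_(i in ~: pfx tau m) yexp k D ((pi^-1)%g i) = ysum D m)%N.
  by move=> mn; have := sumY _ mn; have := yle1 _ mn; have := yle2 _ mn; rewrite yE //; lia.
have ytight2 m : (m <= n)%N ->
    (\sum_(i in ~: pfx tau m) yexp k (~: E) ((sg^-1)%g i) = ysum (~: E) m)%N.
  by move=> mn; have := sumY _ mn; have := yle1 _ mn; have := yle2 _ mn; rewrite yE //; lia.
have pfxD (m : 'I_n) : m \in D -> (0 < m)%N -> pfx tau m = pfx pi m.
  move=> mD m_gt0; have mn := ltnW (ltn_ord m); have [km|mk] := leqP k m.
    by apply: setC_inj; apply: sum_yexp_tight mD km (cpfxC m) (ytight1 _ mn).
  by apply: (sum_xexp_tight mD) (cpfx m) (xtight1 _ mn); rewrite m_gt0.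
have pfxE (m : 'I_n) : m \notin E -> (0 < m)%N -> pfx tau m = pfx sg m.
  rewrite -in_setC => mE m_gt0; have mn := ltnW (ltn_ord m); have [km|mk] := leqP k m.
    by apply: setC_inj; apply: sum_yexp_tight mE km (cpfxC m) (ytight2 _ mn).
  by apply: (sum_xexp_tight mE) (cpfx m) (xtight2 _ mn); rewrite m_gt0.
apply: (@Order.POrderTheory.le_trans _ _ (word tau)).
  apply: word_le_asc => m mD; apply: pfxD => //.
  by rewrite lt0n; apply: contraL mD => /eqP m0; rewrite Des0.
by apply: word_le_desc => m m_gt0 mE; apply: pfxE.
Qed.

(** In a nontrivial relation take the descent monomials with the largest exponents in the
    order of [totsum], and among them the least word sg: pairing with the dual monomial of
    sg isolates its coefficient. *)
Lemma amon_free (c : 'S_n -> rat) :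
  \sum_pi c pi *: amon k pi \in Jeta n k -> forall pi, c pi = 0.
Proof.
move=> Jc pi0; apply/eqP; apply: contraT => c0.
have [s1 c1 max1] := arg_maxnP (P := fun pi => c pi != 0) (fun pi => totsum (Des pi)) c0.
pose Q pi := (c pi != 0) && (totsum (Des pi) == totsum (Des s1)).
have Q1 : Q s1 by rewrite /Q c1 eqxx.
case: (@Order.TotalTheory.arg_minP _ _ _ s1 Q (@word n) Q1) => sg /andP[csg /eqP totsg] min_sg.
have : pair_Delta k ((\sum_pi c pi *: amon k pi) * dual_mon sg) = 0.
  by rewrite mulrC /dual_mon dmonE /mono; have /JetaP -> := Jc.
rewrite mulr_suml /pair_Delta pairing_sum (bigD1 sg) //= big1 ?addr0 => [|pi neq].
  rewrite -scalerAl pairingZ => /eqP; rewrite mulf_eq0 (negPf csg) /=.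
  by rewrite -[_ == 0]negbK -/(pair_Delta _ _) pair_Delta_amon_dual_diag.
rewrite -scalerAl pairingZ -/(pair_Delta _ _); apply/eqP; rewrite mulf_eq0.
have [//|cpi /=] := eqVneq (c pi) 0; apply: contraT => /pair_Delta_amon_dual[le_tot le_word].
have tot : totsum (Des sg) = totsum (Des pi).
  by apply/eqP; rewrite eqn_leq le_tot totsg; exact: max1.
have := le_word tot; have := min_sg pi; rewrite /Q cpi -tot totsg eqxx => /(_ isT) le1 le2.
case/eqP: neq; apply: word_inj; apply/Order.POrderTheory.le_anti.
by rewrite le1 le2.
Qed.

End Independence.

(** * Dominance order *)

Section Dominance.
Implicit Types s t u : seq nat.

Lemma sumn_take_nth s m : sumn (take m.+1 s) = (sumn (take m s) + nth 0 s m)%N.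
Proof.
have [lt_m|le_m] := ltnP m (size s); first by rewrite (take_nth 0%N) // sumn_rcons.
by rewrite !take_oversize ?nth_default ?addn0 // ltnW.
Qed.

Lemma sumn_take_mono s m m' : (m <= m')%N -> (sumn (take m s) <= sumn (take m' s))%N.
Proof.
move/subnK => <-; elim: (m' - m)%N => // d IHd.
by rewrite addSn sumn_take_nth (leq_trans IHd) ?leq_addr.
Qed.

Lemma domleP s t : reflect (sumn s = sumn t /\ forall m, (sumn (take m s) <= sumn (take m t))%N)
  (domle s t).
Proof.
apply: (iffP andP) => [[/eqP st /forallP le_st]|[-> le_st]]; split=> //; last exact/forallP.
move=> m; have [lt_m|le_m] := leqP m (maxn (size s) (size t)); first exact: (le_st (@Ordinal (maxn (size s) (size t)).+1 m lt_m)).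
by rewrite !take_oversize ?st //; lia.
Qed.

Lemma domle_refl s : domle s s.
Proof. exact/domleP. Qed.

Lemma domle_trans t s u : domle s t -> domle t u -> domle s u.
Proof.
move=> /domleP[e1 st] /domleP[e2 tu]; apply/domleP; split=> [|m]; first by rewrite e1.
exact: leq_trans (st m) (tu m).
Qed.

Lemma domle_anti s t : size s = size t -> domle s t -> domle t s -> s = t.
Proof.
move=> size_st /domleP[_ st] /domleP[_ ts]; apply: (@eq_from_nth _ 0%N) => // i _.
have e m : sumn (take m s) = sumn (take m t) by apply/eqP; rewrite eqn_leq st ts.
by have := e i.+1; rewrite !sumn_take_nth e => /addnI.
Qed.

End Dominance.

(** * Linear images and finite spanning families *)

Section LinearImages.
Variables (V W : lmodType rat) (h : V -> W).
Hypotheses (hD : {morph h : u v / u + v}) (hZ : forall q u, h (q *: u) = q *: h u).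

Lemma lspan_image (X : V -> Prop) (Y : W -> Prop) u :
  (forall v, X v -> h v \in lspan Y) -> u \in lspan X -> h u \in lspan Y.
Proof.
move=> XY /lspanP[t [tX ->]].
have h0 : h 0 = 0 by rewrite -[0 in LHS](scale0r 0) hZ scale0r.
rewrite (big_morph h hD h0) big_seq; apply: lspan_sum => p /tX/XY Yp.
by rewrite hZ; apply: lspanZ.
Qed.

End LinearImages.

Lemma lspan_fin (V : lmodType rat) (I : finType) (P : pred I) (f : I -> V) v :
  v \in lspan (fun v => exists2 i, P i & v = f i) ->
  exists c : I -> rat, v = \sum_(i | P i) c i *: f i.
Proof.
case/lspanP => t [tX ->]; elim: t tX => [|[q u] t IHt] tX.
  by exists (fun=> 0); rewrite big_nil big1 // => i _; rewrite scale0r.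
have [|c cE] := IHt; first by move=> p pt; apply: tX; rewrite inE pt orbT.
have [|j Pj /= uE] := tX (q, u); first by rewrite inE eqxx.
exists (fun i => q *+ (i == j) + c i); rewrite big_cons cE /=.
under [RHS]eq_bigr do rewrite scalerDl.
rewrite big_split /=; congr (_ + _); rewrite (bigD1 j) //= eqxx uE big1 ?addr0 //.
by move=> i /andP[_ /negPf->]; rewrite mulr0n scale0r.
Qed.

(** * The dominance filtration and the descent basis of its pieces *)

Section Filtration.
Variables n k : nat.
Hypotheses (k_gt0 : (0 < k)%N) (le_kn : (k <= n)%N).
Implicit Types (D E : {set 'I_n}) (s pi sg tau : 'S_n) (T Z : {set 'I_n}).
Implicit Types lam : seq nat * seq nat.

Lemma dexp_xexp D p : (p < k)%N -> dexp k D p.+1 = xexp k D p.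
Proof. by rewrite /dexp => ->. Qed.

Lemma dexp_yexp D p : (k.-1 <= p)%N -> dexp k D p.+1 = yexp k D p.
Proof.
rewrite /dexp; case: ifP => // pk kp.
by rewrite yexp0 // -/(xexp k D p) xexp0.
Qed.

Lemma lam_ofE pi : lam_of k pi =
  ([seq xexp k (Des pi) p | p <- iota 0 k], [seq yexp k (Des pi) (n.-1 - i) | i <- iota 0 (n - k).+1]).
Proof.
congr pair.
  rewrite (iotaDl 1 0) -map_comp; apply/eq_in_map => i; rewrite mem_iota => /= ik.
  by rewrite add1n dexp_xexp.
apply/eq_in_map => i; rewrite mem_iota => /= ik.
have -> : (n - i = (n.-1 - i).+1)%N by lia.
by rewrite dexp_yexp //; lia.
Qed.

Lemma size_lam_of pi : size (lam_of k pi).1 = k /\ size (lam_of k pi).2 = (n - k).+1.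
Proof. by rewrite /= !size_map !size_iota. Qed.

Lemma sumn_take_iota (f : nat -> nat) r m : (r <= n)%N ->
  (forall p : 'I_n, (r <= p)%N -> f p = 0%N) ->
  sumn (take m [seq f i | i <- iota 0 r]) = (\sum_(p < n | p < m) f p)%N.
Proof.
move=> rn f0; rewrite -map_take take_iota sumnE big_map.
rewrite -[minn m r]subn0 -/(index_iota 0 _).
rewrite (big_nat_widen _ _ n) ?big_mkord; last by lia.
rewrite [LHS]big_mkcond [RHS]big_mkcond; apply: eq_bigr => p _ /=.
rewrite leq_min; case: ltnP => //= pm; case: ltnP => // rp.
by rewrite f0.
Qed.

Lemma sumn_take_lam1 pi m : sumn (take m (lam_of k pi).1) = xsum k (Des pi) m.
Proof.
rewrite lam_ofE /= sumn_take_iota // => p kp; rewrite xexp0 //; lia.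
Qed.

Lemma sumn_take_lam2 pi m : sumn (take m (lam_of k pi).2) = ysum k (Des pi) (n - m).
Proof.
rewrite lam_ofE /snd sumn_take_iota; [|lia|by move=> p kp; rewrite yexp0 //; lia].
rewrite (reindex_inj rev_ord_inj) /ysum /=; apply: eq_big => p; have := ltn_ord p; first by lia.
by move=> pn _; congr yexp; lia.
Qed.

Lemma xsum_ge D m : (n <= m)%N -> xsum k D m = xsum k D n.
Proof.
by move=> nm; apply: eq_bigl => p; rewrite ltn_ord (leq_trans _ nm).
Qed.

Lemma sumn_lam1 pi : sumn (lam_of k pi).1 = (\sum_(p < n) xexp k (Des pi) p)%N.
Proof.
rewrite -[(lam_of k pi).1](@take_oversize _ n); last by rewrite (size_lam_of pi).1.
by rewrite sumn_take_lam1; apply: eq_bigl => p; rewrite ltn_ord.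
Qed.

Lemma sumn_lam2 pi : sumn (lam_of k pi).2 = (\sum_(p < n) yexp k (Des pi) p)%N.
Proof.
rewrite -[(lam_of k pi).2](@take_oversize _ n); last by rewrite (size_lam_of pi).2; lia.
by rewrite sumn_take_lam2 subnn; apply: eq_bigl => p; rewrite leq0n.
Qed.

Lemma bidom_of_bnd lam pi :
  sums_le (fun m => sumn (take m lam.1)) (amon_x k pi) -> sums_le (fun m => sumn (take m lam.2)) (amon_y k pi) ->
  (\sum_i amon_x k pi i = sumn lam.1)%N -> (\sum_i amon_y k pi i = sumn lam.2)%N ->
  bidom (lam_of k pi) lam.
Proof.
move=> Fx Gy sx sy; apply/andP; split; apply/domleP; split.
- rewrite sumn_lam1 -sx [RHS](reindex_inj (@perm_inj _ pi)) /=.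
  by apply: eq_bigr => p _; rewrite /amon_x permK.
- move=> m; rewrite sumn_take_lam1.
  have le_n r : (r <= n)%N -> (xsum k (Des pi) r <= sumn (take r lam.1))%N.
    by move=> rn; have := Fx (pfx pi r); rewrite (sum_pfx (fun p : 'I_n => xexp k _ p)) card_pfx.
  have [mn|nm] := leqP m n; first exact: le_n.
  by rewrite xsum_ge ?(leq_trans (le_n _ (leqnn n))) ?sumn_take_mono // ltnW.
- rewrite sumn_lam2 -sy [RHS](reindex_inj (@perm_inj _ pi)) /=.
  by apply: eq_bigr => p _; rewrite /amon_y permK.
move=> m; rewrite sumn_take_lam2.
have le_n r : (r <= n)%N -> (ysum k (Des pi) (n - r) <= sumn (take r lam.2))%N.
  move=> rn; have := Gy (~: pfx pi (n - r)).
  by rewrite (sum_sfx (fun p : 'I_n => yexp k _ p)) card_pfxC ?leq_subr // subKn.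
have [mn|nm] := leqP m n; first exact: le_n.
have -> : (n - m = n - n)%N by lia.
by rewrite (leq_trans (le_n _ (leqnn n))) ?sumn_take_mono // ltnW.
Qed.

Section BoundedByWord.
Variables (pi : 'S_n) (a b : 'I_n -> nat).
Hypotheses (a_le : forall T, (\sum_(i in T) a i <= xsum k (Des pi) #|T|)%N)
  (b_le : forall T, (\sum_(i in T) b i <= ysum k (Des pi) (n - #|T|))%N)
  (a_tot : (\sum_i a i = \sum_(p < n) xexp k (Des pi) p)%N)
  (b_tot : (\sum_i b i = \sum_(p < n) yexp k (Des pi) p)%N).

Lemma straighten_Ile : clJ (mono a b) \in Ile n k (lam_of k pi).
Proof.
have := @straighten n k k_gt0 le_kn (xsum k (Des pi)) (fun m => ysum k (Des pi) (n - m))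
  _ _ a b a_le b_le a_tot b_tot.
apply: lspan_sub => v [sg [Fx Gy sx sy] ->]; apply: lspan_gen; exists sg => //.
by apply: bidom_of_bnd => [T|T||]; rewrite ?sumn_take_lam1 ?sumn_take_lam2 ?sumn_lam1 ?sumn_lam2.
Qed.

(** One strict inequality between partial sums, preserved by straightening, excludes the
    exponents of pi themselves. *)
Lemma straighten_Ilt_x m : (m <= n)%N ->
  (forall T, #|T| = m -> (\sum_(i in T) a i < xsum k (Des pi) m)%N) ->
  clJ (mono a b) \in Ilt n k (lam_of k pi).
Proof.
move=> mn a_lt.
have Fa : sums_le (fun r => xsum k (Des pi) r - (r == m))%N a.
  move=> T; case: eqP => [e|_]; last by rewrite subn0.
  by have := a_lt _ e; rewrite e; lia.
have := straighten k_gt0 le_kn Fa (b_le : sums_le (fun m => ysum k (Des pi) (n - m)) b) a_tot b_tot.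
apply: lspan_sub => v [sg [Fx Gy sx sy] ->]; apply: lspan_gen; exists sg => //.
apply/andP; split.
  apply: bidom_of_bnd => [T|T||]; rewrite ?sumn_take_lam1 ?sumn_take_lam2 ?sumn_lam1 ?sumn_lam2 //.
  by apply: leq_trans (Fx T) _; rewrite leq_subr.
apply/eqP => /(congr1 (fun l => sumn (take m l.1))); rewrite !sumn_take_lam1 => e.
have := Fx (pfx sg m); rewrite (sum_pfx (fun p : 'I_n => xexp k _ p)) card_pfx // eqxx.
have := a_lt (pfx pi m) (card_pfx _ mn).
by rewrite -/(xsum k (Des sg) m) e; lia.
Qed.

Lemma straighten_Ilt_y m : (m <= n)%N ->
  (forall T, #|T| = (n - m)%N -> (\sum_(i in T) b i < ysum k (Des pi) m)%N) ->
  clJ (mono a b) \in Ilt n k (lam_of k pi).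
Proof.
move=> mn b_lt.
have Gb : sums_le (fun r => ysum k (Des pi) (n - r) - (r == n - m))%N b.
  move=> T; case: eqP => [e|_]; last by rewrite subn0.
  by have := b_lt _ e; rewrite e subKn //; lia.
have := straighten k_gt0 le_kn (a_le : sums_le (xsum k (Des pi)) a) Gb a_tot b_tot.
apply: lspan_sub => v [sg [Fx Gy sx sy] ->]; apply: lspan_gen; exists sg => //.
apply/andP; split.
  apply: bidom_of_bnd => [T|T||]; rewrite ?sumn_take_lam1 ?sumn_take_lam2 ?sumn_lam1 ?sumn_lam2 //.
  by apply: leq_trans (Gy T) _; rewrite leq_subr.
apply/eqP => /(congr1 (fun l => sumn (take (n - m) l.2))); rewrite !sumn_take_lam2 subKn // => e.
have := Gy (~: pfx sg m); rewrite (sum_sfx (fun p : 'I_n => yexp k _ p)) card_pfxC // subKn // eqxx.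
have := b_lt (~: pfx pi m) (card_pfxC _ mn).
by rewrite -/(ysum k (Des sg) m) e; lia.
Qed.

End BoundedByWord.

(** Rearranging the letters does not change the sorted exponents. *)
Lemma dmon_Ile pi sg : clJ (dmon k (Des pi) sg) \in Ile n k (lam_of k pi).
Proof.
rewrite dmonE; apply: straighten_Ile => [T|T||]; [exact: sum_xexp_le | exact: sum_yexp_le |..].
  by rewrite (reindex_inj (@perm_inj _ sg)) /=; apply: eq_bigr => p _; rewrite permK.
by rewrite (reindex_inj (@perm_inj _ sg)) /=; apply: eq_bigr => p _; rewrite permK.
Qed.

Lemma bidom_trans lam2 lam1 lam3 : bidom lam1 lam2 -> bidom lam2 lam3 -> bidom lam1 lam3.
Proof.
by move=> /andP[d1 d2] /andP[e1 e2]; rewrite /bidom (domle_trans d1 e1) (domle_trans d2 e2).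
Qed.

Lemma bidom_anti pi sg : bidom (lam_of k pi) (lam_of k sg) -> bidom (lam_of k sg) (lam_of k pi) ->
  lam_of k pi = lam_of k sg.
Proof.
move=> /andP[d1 d2] /andP[e1 e2].
have [s1 s2] := size_lam_of pi; have [t1 t2] := size_lam_of sg.
by apply: injective_projections; apply: domle_anti => //; rewrite ?s1 ?s2.
Qed.

Lemma Ile_sub pi lam u : bidom (lam_of k pi) lam -> u \in Ile n k (lam_of k pi) -> u \in Ile n k lam.
Proof.
move=> le_pi; apply: lspan_sub => v [sg le_sg ->]; apply: lspan_gen; exists sg => //.
exact: bidom_trans le_pi.
Qed.

Lemma Ile_Ilt pi lam u : bidom (lam_of k pi) lam -> lam_of k pi != lam ->
  u \in Ile n k (lam_of k pi) -> u \in Ilt n k lam.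
Proof.
move=> le_pi neq_pi; apply: lspan_sub => v [sg le_sg ->]; apply: lspan_gen; exists sg => //.
rewrite (bidom_trans le_sg le_pi) /=; apply: contra neq_pi => /eqP sgE.
by rewrite -sgE eq_sym; apply/eqP/bidom_anti => //; rewrite sgE.
Qed.

Lemma actxy_dmon s D pi : actxy s (dmon k D pi) = dmon k D (pi * s)%g.
Proof. by rewrite !dmonE actxy_mono; apply: eq_mono => i; rewrite invMg permM. Qed.

Lemma actHE s f : actH s (clJ f) = @clJ n k (actxy s f).
Proof.
apply: qmapE; first exact: actxyB.
by move=> g; apply: Jeta_act.
Qed.

Lemma clJ_surj (u : Heta' n k) : exists f, u = clJ f.
Proof. by exists (generic_quotient.repr u); rewrite /clJ qclass_repr. Qed.

Lemma actHD s : {morph @actH n k s : u v / u + v}.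
Proof.
by move=> u v; have [f ->] := clJ_surj u; have [g ->] := clJ_surj v; rewrite -clJD !actHE actxyD clJD.
Qed.

Lemma actHZ s q u : @actH n k s (q *: u) = q *: actH s u.
Proof. by have [f ->] := clJ_surj u; rewrite -clJZ !actHE actxyZ clJZ. Qed.

Lemma actHB s : {morph @actH n k s : u v / u - v}.
Proof. by move=> u v; rewrite actHD -scaleN1r actHZ scaleN1r. Qed.

Lemma actH_Ile lam s u : u \in Ile n k lam -> actH s u \in Ile n k lam.
Proof.
apply: lspan_image => [||v [pi le_pi ->]]; [exact: actHD | exact: actHZ |].
by rewrite actHE /amon actxy_dmon; apply: Ile_sub le_pi _; exact: dmon_Ile.
Qed.

Lemma actH_Ilt lam s u : u \in Ilt n k lam -> actH s u \in Ilt n k lam.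
Proof.
apply: lspan_image => [||v [pi /andP[le_pi neq_pi] ->]]; [exact: actHD | exact: actHZ |].
by rewrite actHE /amon actxy_dmon; apply: Ile_Ilt neq_pi _ => //; exact: dmon_Ile.
Qed.

Section Lam.
Variable lam : seq nat * seq nat.

Lemma clID : {morph @clI n k lam : u v / u + v}.
Proof. exact: qclassD. Qed.
Lemma clIZ q u : @clI n k lam (q *: u) = q *: clI lam u.
Proof. exact: qclassZ. Qed.
Lemma clI_eq0 u : (@clI n k lam u == 0) = (u \in Ilt n k lam).
Proof.
have cl0 : @clI n k lam 0 = 0 by rewrite -[0 in LHS](scale0r 0) clIZ scale0r.
by rewrite -cl0; apply/eqP/idP => [/qclassP|Ju]; [|apply/qclassP]; rewrite subr0.
Qed.
Lemma clI_sum (I : Type) (r : seq I) P (F : I -> Heta' n k) :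
  @clI n k lam (\sum_(i <- r | P i) F i) = \sum_(i <- r | P i) clI lam (F i).
Proof.
apply: (big_morph (@clI n k lam)); first exact: clID.
by apply/eqP; rewrite clI_eq0; exact: lspan0.
Qed.

Lemma actRE s u : @actR n k lam s (clI lam u) = clI lam (actH s u).
Proof. by apply: qmapE; [exact: actHB | move=> v; exact: actH_Ilt]. Qed.

Hypothesis lam_bip : is_bipartition n k lam.

Lemma geq_nth (t : seq nat) i : sorted geq t -> (nth 0 t i.+1 <= nth 0 t i)%N.
Proof.
move=> t_sorted; have [lt_i|le_i] := ltnP i.+1 (size t); last by rewrite nth_default.
have geq_tr : transitive geq by move=> x y z /= yx zy; exact: leq_trans zy yx.
have := sorted_leq_nth geq_tr leqnn 0%N t_sorted; apply; rewrite ?inE //; exact: ltnW.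
Qed.

Lemma Alam_lam_of pi : Alam n k (lam_of k pi) = Des pi.
Proof.
apply/setP => q; rewrite inE; have [q0|q_gt0] := posnP q; first by rewrite Des0.
have lt_qn := ltn_ord q; have lt_p : (q.-1 < n)%N by lia.
have qE : q = (Ordinal lt_p).+1 :> nat by rewrite /= prednK.
rewrite lam_ofE /part /fst /snd !succnK; have [qk|kq] := ltnP q k.
  rewrite !(nth_map 0%N) ?size_iota ?nth_iota ?add0n; try lia.
  by have := @xexpS n k (Des pi) _ _ qE qk; rewrite /= => ->; case: (q \in _); lia.
rewrite !(nth_map 0%N) ?size_iota ?nth_iota ?add0n; try lia.
have -> : (n.-1 - (n - q).-1 = q)%N by lia.
have -> : (n.-1 - (n - q) = q.-1)%N by lia.
by have := @yexpS n k (Des pi) _ _ qE kq; rewrite /= => ->; case: (q \in _); lia.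
Qed.

(** A bipartition with steps 0 and 1 is determined by the positions of its steps 1. *)
Lemma lam_of_Alam pi : Des pi = Alam n k lam -> lam_of k pi = lam.
Proof.
case: (lam) lam_bip => mu nu /= [[szmu smu mu0 dmu] [sznu snu nu0 dnu]] DA.
have xE (p : 'I_n) : nth 0%N mu p = xexp k (Des pi) p.
  rewrite -(@xexp_charac n k k_gt0 le_kn (Des pi) (fun p => nth 0%N mu p)) // => [r kr|r q qr qk].
    have [e|ne] := eqVneq (r : nat) k.-1; first by rewrite e.
    by rewrite nth_default // szmu; lia.
  have := dmu q; have := geq_nth r smu; rewrite DA inE qk -qr /part /= qr /= => le_nth.
  by case: eqP => /=; lia.
have yE (p : 'I_n) : nth 0%N nu (n.-1 - p) = yexp k (Des pi) p.
  rewrite -(@yexp_charac n k k_gt0 (Des pi) (fun p => nth 0%N nu (n.-1 - p))) // => [r rk|r q qr kq].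
    have [e|ne] := eqVneq (r : nat) k.-1; last by rewrite nth_default // sznu; have := ltn_ord r; lia.
    by rewrite e -[RHS]nu0 /part /=; congr nth; lia.
  have qn := ltn_ord q; have := dnu (n - q)%N; have := geq_nth (n.-1 - q) snu.
  rewrite DA inE [(q < k)%N]ltnNge kq /= /part /=.
  have -> : (n.-1 - q).+1 = (n.-1 - r)%N by lia.
  have -> : (n - q).-1 = (n.-1 - q)%N by lia.
  have -> : (n - q)%N = (n.-1 - r)%N by lia.
  by case: eqP => /=; lia.
rewrite lam_ofE; congr pair.
  apply: (@eq_from_nth _ 0%N); rewrite size_map size_iota ?szmu // => i ik.
  rewrite (nth_map 0%N) ?size_iota // nth_iota // add0n.
  have lt_in : (i < n)%N by lia.
  by rewrite -(xE (Ordinal lt_in)).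
apply: (@eq_from_nth _ 0%N); rewrite size_map size_iota ?sznu // => i ik.
rewrite (nth_map 0%N) ?size_iota // nth_iota // add0n.
have lt_in : (n.-1 - i < n)%N by lia.
by rewrite -(yE (Ordinal lt_in)) /=; congr nth; lia.
Qed.

Lemma Des_Alam pi : (Des pi == Alam n k lam) = (lam_of k pi == lam).
Proof. by apply/eqP/eqP => [/lam_of_Alam|<-]; rewrite ?Alam_lam_of. Qed.

Lemma clJ_amon_Ile pi : Des pi == Alam n k lam -> clJ (amon k pi) \in Ile n k lam.
Proof.
rewrite Des_Alam => /eqP e; apply: lspan_gen; exists pi => //.
by rewrite e /bidom !domle_refl.
Qed.

(** The independence of all the descent monomials modulo J passes to the quotient, because
    the subspace that is factored out is spanned by descent monomials not in the family. *)
Lemma camon_basis :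
  is_basis [pred pi : 'S_n | Des pi == Alam n k lam] (camon k lam) (Rlam n k lam).
Proof.
split=> [v|c c0].
  split=> [/asboolP[u Iu ->]|[c ->]]; last first.
    apply/asboolP; exists (\sum_(pi | Des pi == Alam n k lam) c pi *: clJ (amon k pi)).
      by apply: lspan_sum => pi /clJ_amon_Ile; apply: lspanZ.
    by rewrite clI_sum; apply: eq_bigr => pi _; rewrite clIZ.
  apply: lspan_fin; apply: lspan_image Iu => [||w [pi le_pi ->]]; [exact: clID | exact: clIZ |].
  have [e|ne] := eqVneq (lam_of k pi) lam.
    by apply: lspan_gen; exists pi; rewrite //= Des_Alam e.
  have : clJ (amon k pi) \in Ilt n k lam by apply: lspan_gen; exists pi; rewrite // le_pi ne.
  by rewrite -clI_eq0 => /eqP ->; exact: lspan0.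
have : \sum_(pi | Des pi == Alam n k lam) c pi *: clJ (amon k pi) \in Ilt n k lam.
  rewrite -clI_eq0; apply/eqP; rewrite -[RHS]c0 clI_sum; apply: eq_bigr => pi _.
  by rewrite clIZ.
case/lspan_fin => d dE pi /= Dpi.
pose e pi := if Des pi == Alam n k lam then c pi else
  if bidom (lam_of k pi) lam then - d pi else 0.
suff /(_ pi) : forall pi, e pi = 0 by rewrite /e Dpi.
apply: (amon_free k_gt0 le_kn); rewrite -clJ_eq0 clJ_sum.
rewrite (bigID (fun pi => Des pi == Alam n k lam)) /=.
rewrite (eq_bigr (fun pi => c pi *: clJ (amon k pi))); last first.
  by move=> tau Dtau; rewrite clJZ /e Dtau.
rewrite dE addr_eq0 -sumrN; apply/eqP; rewrite [LHS]big_mkcond [RHS]big_mkcond.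
apply: eq_bigr => tau _; rewrite /e Des_Alam andbC; case: eqP => //= _.
by rewrite clJZ; case: ifP; rewrite ?scale0r ?oppr0 // scaleNr opprK.
Qed.

End Lam.
End Filtration.

(** * Permutations sorted by a key *)

Section Prefixes.
Variable n : nat.
Implicit Types (pi sg tau : 'S_n) (Y Z : {set 'I_n}).

(** Down-closed sets are the initial segments of the sorted word. *)
Lemma pfx_downset (key : 'I_n -> nat) sg Y :
  (forall p q : 'I_n, (p < q)%N -> (key (sg p) < key (sg q))%N) ->
  (forall i l, (key l < key i)%N -> i \in Y -> l \in Y) -> pfx sg #|Y| = Y.
Proof.
move=> sg_inc Y_down; apply/setP => i; rewrite -[i](permKV sg).
move: ((sg^-1)%g i) => p; rewrite pfx_mem; apply/idP/idP => [pY|Yp].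
  apply: contraLR pY => Yp; rewrite -leqNgt -[leqRHS](card_pfx sg) ?(ltnW (ltn_ord p)) //.
  apply/subset_leq_card/subsetP => l; rewrite -[l](permKV sg) pfx_mem.
  move: ((sg^-1)%g l) => q Yq; rewrite ltnNge leq_eqVlt; apply: contra Yp.
  by case/orP => [/eqP/ord_inj->//|/sg_inc/Y_down->].
rewrite -[leqLHS](card_pfx sg) //; apply/subset_leq_card/subsetP => l.
rewrite -[l](permKV sg) pfx_mem; move: ((sg^-1)%g l) => q.
by rewrite ltnS leq_eqVlt => /orP[/eqP/ord_inj->//|/sg_inc/Y_down->].
Qed.

Lemma pfx_perm_eq pi sg (p : 'I_n) : pfx sg p = pfx pi p -> pfx sg p.+1 = pfx pi p.+1 -> sg p = pi p.
Proof.
move=> /setP/(_ (sg p)); rewrite pfx_mem ltnn => /esym/negbT; rewrite inE -leqNgt => le_p.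
move=> /setP/(_ (sg p)); rewrite pfx_mem ltnSn => /esym; rewrite inE => lt_p.
have e : p = (pi^-1)%g (sg p) by apply/ord_inj; lia.
by rewrite [in RHS]e permKV.
Qed.

Lemma sorted_perm_uniq (key : 'I_n -> nat) pi sg :
  (forall p q : 'I_n, (p < q)%N -> (key (pi p) < key (pi q))%N) ->
  (forall p q : 'I_n, (p < q)%N -> (key (sg p) < key (sg q))%N) -> pi = sg.
Proof.
move=> pi_inc sg_inc.
have pfxE r : (r <= n)%N -> pfx pi r = pfx sg r.
  move=> rn; rewrite -{2}(card_pfx pi rn); apply/esym/(pfx_downset sg_inc) => i l.
  rewrite -[i](permKV pi) -[l](permKV pi) !pfx_mem => ltk pr; apply: leq_ltn_trans pr.
  by rewrite leqNgt; apply: contraTN ltk => /pi_inc lt; rewrite -leqNgt ltnW.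
by apply/permP => p; apply: pfx_perm_eq; apply: pfxE => //; exact: ltnW.
Qed.

End Prefixes.

(** * Redistribution of a block across a cut *)

Section Redistribution.
Variables (n : nat) (pi : 'S_n) (m1 t m2 : nat).
Hypotheses (m1t : (m1 < t)%N) (tm2 : (t < m2)%N) (m2n : (m2 <= n)%N).
Implicit Types (sg : 'S_n) (Z : {set 'I_n}).

(** The words obtained from pi by redistributing the letters of the positions m1, .., m2 - 1
    (0-based) over the two sides of the cut at t, in increasing order on each side. *)
Definition redist sg :=
  [&& [forall p : 'I_n, (p.+1 <= m1)%N || (m2 + 1 <= p.+1)%N ==> (sg p == pi p)],
      [forall p : 'I_n, forall q : 'I_n, [&& m1 + 1 <= p.+1, p < q & q.+1 <= t]%N ==> (sg p < sg q)%N] &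
      [forall p : 'I_n, forall q : 'I_n, [&& t + 1 <= p.+1, p < q & q.+1 <= m2]%N ==> (sg p < sg q)%N]].

Lemma redistP sg : reflect
  [/\ forall p : 'I_n, (p < m1)%N || (m2 <= p)%N -> sg p = pi p,
      forall p q : 'I_n, (m1 <= p)%N -> (p < q)%N -> (q < t)%N -> (sg p < sg q)%N &
      forall p q : 'I_n, (t <= p)%N -> (p < q)%N -> (q < m2)%N -> (sg p < sg q)%N]
  (redist sg).
Proof.
apply: (iffP and3P) => [[/forallP H1 /forallP H2 /forallP H3]|[H1 H2 H3]]; split.
- by move=> p Hp; apply/eqP; move/implyP: (H1 p); apply; lia.
- by move=> p q *; move/forallP/(_ q)/implyP: (H2 p); apply; lia.
- by move=> p q *; move/forallP/(_ q)/implyP: (H3 p); apply; lia.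
- by apply/forallP => p; apply/implyP => Hp; apply/eqP/H1; lia.
- by apply/forallP => p; apply/forallP => q; apply/implyP => /and3P[*]; apply: H2; lia.
- by apply/forallP => p; apply/forallP => q; apply/implyP => /and3P[*]; apply: H3; lia.
Qed.

(** The sets that can occur as the first t letters of a redistributed word. *)
Definition between Z := (pfx pi m1 \subset Z) && (Z \subset pfx pi m2).

(** The words of [redist] with first t letters Z are sorted for this key, which puts the fixed
    letters before m1 first, then the rest of Z, then the rest of the block, then the fixed
    letters from m2 on. Multiples of n separate the four groups. *)
Definition blockkey Z (i : 'I_n) : nat :=
  let r : nat := (pi^-1)%g i in
  if (r < m1)%N then r else if (m2 <= r)%N then (3 * n + r)%N
  else if i \in Z then (n + i)%N else (2 * n + i)%N.

Lemma redist_block sg (p : 'I_n) : redist sg ->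
  ((pi^-1)%g (sg p) = p) \/ [/\ (m1 <= p < m2)%N & (m1 <= (pi^-1)%g (sg p) < m2)%N].
Proof.
case/redistP => fixed _ _; have [out|] := boolP ((p < m1)%N || (m2 <= p)%N).
  by left; rewrite fixed // permK.
rewrite negb_or -leqNgt -ltnNge => p_in.
set r := (pi^-1)%g (sg p); have [out|] := boolP ((r < m1)%N || (m2 <= r)%N).
  by left; apply: (@perm_inj _ sg); rewrite fixed // permKV.
by rewrite negb_or -leqNgt -ltnNge => r_in; right.
Qed.

Lemma redist_between sg : redist sg -> between (pfx sg t).
Proof.
move=> sgB; apply/andP; split; apply/subsetP => i; rewrite -[i](permKV sg) pfx_mem;
move: ((sg^-1)%g i) => p; rewrite ?pfx_mem inE => Hp;
by case: (redist_block p sgB) => [e|[]]; rewrite ?e in Hp *; lia.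
Qed.

Lemma redist_key sg : redist sg ->
  forall p q : 'I_n, (p < q)%N -> (blockkey (pfx sg t) (sg p) < blockkey (pfx sg t) (sg q))%N.
Proof.
move=> sgB p q pq; have /redistP[fixed incl incr] := sgB.
have keyE r : blockkey (pfx sg t) (sg r) =
    if (r < m1)%N then r : nat else if (m2 <= r)%N then (3 * n + r)%N
    else if (r < t)%N then (n + sg r)%N else (2 * n + sg r)%N.
  rewrite /blockkey pfx_mem; case: (redist_block r sgB) => [->//|[/andP[r1 r2] /andP[s1 s2]]].
  by rewrite [(_ < m1)%N]ltnNge s1 [(m2 <= _)%N]leqNgt s2 [(r < m1)%N]ltnNge r1 [(m2 <= r)%N]leqNgt r2.
rewrite !keyE; have := ltn_ord (sg p); have := ltn_ord (sg q); have := incl p q; have := incr p q.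
have := ltn_ord p; have := ltn_ord q.
by case: (ltnP p m1); case: (ltnP q m1); case: (leqP m2 p); case: (leqP m2 q);
  case: (ltnP p t); case: (ltnP q t); lia.
Qed.

Lemma redist_exists Z : #|Z| = t -> between Z -> exists2 sg, redist sg & pfx sg t = Z.
Proof.
move=> cZ /andP[/subsetP Zl /subsetP Zr].
have key_inj : injective (blockkey Z).
  move=> i l; rewrite /blockkey; have := ltn_ord i; have := ltn_ord l.
  have := ltn_ord ((pi^-1)%g i); have := ltn_ord ((pi^-1)%g l).
  have posE : ((pi^-1)%g i = (pi^-1)%g l :> nat) -> i = l by move/ord_inj/perm_inj.
  by do !case: ifP => ? //; move=> *; solve [exfalso; lia | apply: ord_inj; lia | apply: posE; lia].
have [sg sgP] := sort_perm key_inj.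
have sg_inc (p q : 'I_n) : (p < q)%N -> (blockkey Z (sg p) < blockkey Z (sg q))%N by rewrite sgP.
have mem (i : 'I_n) : [/\ ((pi^-1)%g i < m1)%N -> i \in Z & i \in Z -> ((pi^-1)%g i < m2)%N].
  by split=> [lt|/Zr]; [apply: Zl|]; rewrite ?inE.
have tn : (t <= n)%N by lia.
have pfxZ : pfx sg t = Z.
  rewrite -cZ; apply: (pfx_downset sg_inc) => i l.
  have := ltn_ord i; have := ltn_ord l; have [? ?] := mem i; have [? ?] := mem l.
  have := ltn_ord ((pi^-1)%g i); have := ltn_ord ((pi^-1)%g l).
  rewrite /blockkey; do !case: ifP => ?; lia.
have pfxE r : (r <= m1)%N || (m2 <= r <= n)%N -> pfx sg r = pfx pi r.
  move=> r_out; have rn : (r <= n)%N by lia.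
  rewrite -{1}(card_pfx pi rn); apply: (pfx_downset sg_inc) => i l; rewrite !inE /blockkey.
  have := ltn_ord i; have := ltn_ord l.
  have := ltn_ord ((pi^-1)%g i); have := ltn_ord ((pi^-1)%g l).
  do !case: ifP => ?; lia.
exists sg => //; apply/redistP.
have fixed (p : 'I_n) : (p < m1)%N || (m2 <= p)%N -> sg p = pi p.
  by move=> p_out; have := ltn_ord p => pn; apply: pfx_perm_eq; apply: pfxE; lia.
have inblock (p : 'I_n) : (m1 <= p < m2)%N -> (m1 <= (pi^-1)%g (sg p) < m2)%N.
  move=> p_in; have := pfx_mem sg m1 p; have := pfx_mem sg m2 p.
  by rewrite (pfxE m1) ?leqnn // (pfxE m2) ?leqnn ?m2n ?orbT // !inE; lia.
have inZ p : (sg p \in Z) = (p < t)%N by rewrite -pfxZ pfx_mem.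
have keyE (p : 'I_n) : (m1 <= p < m2)%N ->
    blockkey Z (sg p) = if (p < t)%N then (n + sg p)%N else (2 * n + sg p)%N.
  move=> /inblock /andP[b1 b2].
  by rewrite /blockkey inZ [(_ < m1)%N]ltnNge b1 [(m2 <= _)%N]leqNgt b2.
split=> // p q Hp pq Hq; have := sg_inc p q pq; rewrite !keyE; try lia.
  by case: ifP; case: ifP; lia.
by case: ifP; case: ifP; lia.
Qed.

Lemma redist_inj sg tau : redist sg -> redist tau -> pfx sg t = pfx tau t -> sg = tau.
Proof.
move=> sgB tauB e; apply: (@sorted_perm_uniq _ (blockkey (pfx sg t))); first exact: redist_key.
by rewrite e; exact: redist_key.
Qed.

(** A redistributed word is determined by the set of its first t letters. *)
Lemma sum_redist (V : nmodType) (F : {set 'I_n} -> V) :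
  \sum_(sg | redist sg) F (pfx sg t) = \sum_(Z : {set 'I_n} | (#|Z| == t) && between Z) F Z.
Proof.
rewrite (partition_big (fun sg => pfx sg t) (fun Z : {set 'I_n} => (#|Z| == t) && between Z)) /=; last first.
  by move=> sg sgB; rewrite redist_between // card_pfx ?eqxx //; lia.
apply: eq_bigr => Z /andP[/eqP cZ bZ]; have [sg sgB sgZ] := redist_exists cZ bZ.
rewrite (big_pred1 sg) ?sgZ // => tau; apply/andP/eqP => [[tauB /eqP tauZ]|->].
  by apply: redist_inj; rewrite ?sgZ.
by rewrite sgZ.
Qed.

End Redistribution.

(** * The Garnir relation *)

Section Garnir.
Variables n k : nat.
Hypotheses (k_gt0 : (0 < k)%N) (le_kn : (k <= n)%N).
Implicit Types (D E : {set 'I_n}) (s sg tau : 'S_n) (T Z : {set 'I_n}).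

Lemma xexp_lt E (q : 'I_n) (r u : nat) : q \in E -> (r < q <= u)%N -> (q < k)%N ->
  (xexp k E u < xexp k E r)%N.
Proof.
move=> qE rqu qk; apply: proper_card; apply/properP; split.
  by apply/subsetP => j; rewrite !inE; case: (j \in E) => //=; lia.
by exists q; rewrite !inE qE /=; lia.
Qed.

Lemma yexp_lt E (q : 'I_n) (r u : nat) : q \in E -> (r < q <= u)%N -> (k <= q)%N ->
  (yexp k E r < yexp k E u)%N.
Proof.
move=> qE rqu qk; apply: proper_card; apply/properP; split.
  by apply/subsetP => j; rewrite !inE; case: (j \in E) => //=; lia.
by exists q; rewrite !inE qE /=; lia.
Qed.

Lemma xexp_D1 D (t : 'I_n) r : t \in D -> xexp k D r = (xexp k (D :\ t) r + ((r < t) && (t < k)))%N.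
Proof.
move=> tD; rewrite /xexp (cardsD1 t) inE tD /= addnC; congr (_ + _)%N.
by apply: eq_card => j; rewrite !inE andbA.
Qed.

Lemma yexp_D1 D (t : 'I_n) r : t \in D -> yexp k D r = (yexp k (D :\ t) r + ((t <= r) && (k <= t)))%N.
Proof.
move=> tD; rewrite /yexp (cardsD1 t) inE tD /= addnC andbC; congr (_ + _)%N.
by apply: eq_card => j; rewrite !inE andbA.
Qed.

Variables (pi : 'S_n) (t : 'I_n) (m1 m2 : nat).
Let D := Des pi.
Hypotheses (tD : t \in D) (m1t : (m1 < t)%N) (tm2 : (t < m2)%N) (m2n : (m2 <= n)%N).
Hypothesis gap1 : forall q : 'I_n, (m1 < q < t)%N -> q \notin D.
Hypothesis gap2 : forall q : 'I_n, (t < q < m2)%N -> q \notin D.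
Hypothesis m1D : m1 = 0%N \/ exists2 q : 'I_n, q \in D & q = m1 :> nat.
Hypothesis m2D : m2 = n \/ exists2 q : 'I_n, q \in D & q = m2 :> nat.

Let cut_x (i : 'I_n) := xexp k (D :\ t) ((pi^-1)%g i).
Let cut_y (i : 'I_n) := yexp k (D :\ t) ((pi^-1)%g i).

(** The monomial of pi with the layer of the descent t moved from the first t letters (or their
    complement, if t is on the y-side) to Z. *)
Definition cutmono Z := mono (fun i => cut_x i + ((t < k) && (i \in Z)))%N
                             (fun i => cut_y i + ((k <= t) && (i \notin Z)))%N.

(** This is a monomial times an elementary symmetric polynomial. *)
Lemma cutmono_sum_Jeta : \sum_(Z : {set 'I_n} | #|Z| == t) cutmono Z \in Jeta n k.
Proof.
have [kt|tk] := leqP k t.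
  have nt : (0 < n - t)%N by have := ltn_ord t; lia.
  suff -> : \sum_(Z : {set 'I_n} | #|Z| == t) cutmono Z =
      \sum_(Z : {set 'I_n} | #|Z| == (n - t)%N) mono cut_x (fun i => cut_y i + (i \in Z))%N.
    exact: esymy_Jeta.
  rewrite (reindex_inj (@setC_inj _)) /=; apply: eq_big => [Z|Z _].
    rewrite cardsCs setCK card_ord; have := max_card_ord Z; have := ltn_ord t.
    by move: #|Z| => z; lia.
  by apply: eq_mono => i; rewrite ?inE ?kt ?negbK // ltnNge kt addn0.
suff -> : \sum_(Z : {set 'I_n} | #|Z| == t) cutmono Z =
    \sum_(Z : {set 'I_n} | #|Z| == t) mono (fun i => cut_x i + (i \in Z))%N cut_y.
  by apply: esymx_Jeta => //; apply: leq_ltn_trans m1t.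
by apply: eq_bigr => Z _; apply: eq_mono => i; rewrite ?tk // leqNgt tk addn0.
Qed.

(** Without the layer at t, the exponents are constant on the block, so that they do not see
    the redistribution. *)
Lemma cutmono_redist sg : redist pi m1 t m2 sg -> cutmono (pfx sg t) = dmon k D sg.
Proof.
move=> sgB; rewrite dmonE; apply: eq_mono => i; rewrite -[i](permKV sg);
move: ((sg^-1)%g i) => p; rewrite permK pfx_mem /cut_x /cut_y.
  rewrite (xexp_D1 _ tD) andbC; congr (_ + _)%N.
  case: (redist_block m1t tm2 m2n p sgB) => [->//|[p_in r_in]]; apply: eq_card => j.
  rewrite [LHS]in_set [RHS]in_set in_setD1.
  case: eqP => //= /eqP jt; case jD: (j \in D) => //=.
  have := @gap1 j; have := @gap2 j; rewrite jD.
  have : (j : nat) != t by rewrite (inj_eq val_inj).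
  by lia.
rewrite (yexp_D1 _ tD) andbC -leqNgt; congr (_ + _)%N.
case: (redist_block m1t tm2 m2n p sgB) => [->//|[p_in r_in]]; apply: eq_card => j.
  rewrite [LHS]in_set [RHS]in_set in_setD1.
case: eqP => //= /eqP jt; case jD: (j \in D) => //=.
have := @gap1 j; have := @gap2 j; rewrite jD.
have : (j : nat) != t by rewrite (inj_eq val_inj).
by lia.
Qed.

(** Moving the layer preserves dominance by the exponents of pi. The sum over a t-set T (an
    (n - t)-set on the y-side) can only reach its bound if T is the layer itself and maximizes
    the sum of the exponents without it. If Z misses a letter before m1, or contains one from m2 on,
    the layer is not maximal: m1 and m2 are descents, where these exponents drop
    strictly. If such a descent is on the other side of k, the layer meets the support of the
    other variables instead, and the monomial is in J. *)
Lemma cutmono_lower Z : #|Z| = t -> ~~ between pi m1 m2 Z ->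
  clJ (cutmono Z) \in Ilt n k (lam_of k pi).
Proof.
move=> cZ badZ; have lt_tn := ltn_ord t.
have memJ a b : mono a b \in Jeta n k -> @clJ n k (mono a b) \in Ilt n k (lam_of k pi).
  by rewrite -clJ_eq0 => /eqP->; exact: lspan0.
have ax'_dec (p q : 'I_n) : (p <= q)%N -> (cut_x (pi q) <= cut_x (pi p))%N.
  by move=> pq; rewrite /cut_x !permK xexp_dec.
have ay'_inc (p q : 'I_n) : (p <= q)%N -> (cut_y (pi p) <= cut_y (pi q))%N.
  by move=> pq; rewrite /cut_y !permK yexp_inc.
have axE i : (cut_x i + ((t < k) && (i \in pfx pi t)))%N = xexp k D ((pi^-1)%g i).
  by rewrite (xexp_D1 _ tD) inE andbC.
have ayE i : (cut_y i + ((k <= t) && (i \in ~: pfx pi t)))%N = yexp k D ((pi^-1)%g i).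
  by rewrite (yexp_D1 _ tD) !inE -leqNgt andbC.
have bad : exists i, ((pi^-1)%g i < m1)%N && (i \notin Z) || (m2 <= (pi^-1)%g i)%N && (i \in Z).
  move: badZ; rewrite negb_and => /orP[] /subsetPn[i]; rewrite inE => i1 i2; exists i.
    by rewrite i1 i2.
  by rewrite i1 [(m2 <= _)%N]leqNgt i2 orbT.
have D1 (q : 'I_n) : q \in D -> q != t :> nat -> q \in D :\ t.
  by move=> qD neq; rewrite in_setD1 qD andbT -val_eqE.
have [kt|tk] := leqP k t.
  have tkF : (t < k)%N = false by rewrite ltnNge kt.
  have cE : cutmono Z = mono cut_x (fun i => cut_y i + (i \in ~: Z))%N.
    by apply: eq_mono => i; rewrite ?in_setC ?tkF ?kt ?addn0.
  rewrite cE.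
  have [/existsP[i /andP[iZ ai]]|/existsPn Za] := boolP [exists i, (i \notin Z) && (0 < cut_x i)%N].
    by apply/memJ/(@xy_Jeta _ _ k_gt0 le_kn _ _ i) => //; rewrite inE iZ addn1.
  have cY : #|~: Z| = (n - t)%N by rewrite cardsCs setCK card_ord cZ.
  have subt : (n - (n - t) = t)%N by lia.
  have ayS i : yexp k D ((pi^-1)%g i) = (cut_y i + (i \in ~: pfx pi t))%N by rewrite -ayE kt.
  apply: (@straighten_Ilt_y _ _ k_gt0 le_kn _ _ _ _ _ _ _ t) => [T|T||||T cT].
  - apply: leq_trans (sum_xexp_le _ _ pi T); apply: leq_sum => i _.
    by rewrite -axE leq_addr.
  - apply: leq_trans (sum_add_indic_sfx T (~: Z) ay'_inc) _; rewrite cY subt.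
    rewrite /ysum -(sum_sfx (fun p : 'I_n => yexp k D p) pi).
    by apply: leq_sum => i _; rewrite ayS.
  - rewrite [RHS](reindex_inj (@perm_inj _ pi^-1%g)) /=; apply: eq_bigr => i _.
    by rewrite -axE tkF addn0.
  - rewrite [RHS](reindex_inj (@perm_inj _ pi^-1%g)) /=.
    rewrite [RHS](eq_bigr _ (fun i _ => ayS i)) !big_split /= !sum_mem cY.
    by rewrite card_pfxC // ltnW.
  - exact: ltnW.
  rewrite /ysum -(sum_sfx (fun p : 'I_n => yexp k D p) pi) [X in (_ < X)%N](eq_bigr _ (fun i _ => ayS i)).
  have cP : #|~: pfx pi t| = (n - t)%N by rewrite card_pfxC // ltnW.
  rewrite !big_split /= !sum_indic setIid cP.
  have le_T : (\sum_(i in T) cut_y i <= \sum_(i in ~: pfx pi t) cut_y i)%N.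
    by have := sum_le_sfx T ay'_inc; rewrite cT subt.
  have [TZ|neqTZ] := eqVneq T (~: Z); last first.
    suff lt_c : (#|T :&: ~: Z| < n - t)%N by rewrite -addnS; apply: leq_add.
    rewrite -cT; apply: proper_card; rewrite properE subsetIl /=; apply: contra neqTZ.
    by rewrite subsetI subxx /= => sTZ; rewrite eqEcard sTZ cY cT /=.
  rewrite TZ setIid cY ltn_add2r.
  apply: (@sum_threshold_lt _ _ _ _ (yexp k (D :\ t) t)); first by rewrite cY cP.
  - by move=> i; rewrite !inE -leqNgt => ti; apply: yexp_inc.
  - by move=> i _; rewrite !inE negbK => ti; apply/yexp_inc/ltnW.
  have [i /orP[/andP[im1 iZ]|/andP[im2 iZ]]] := bad; exists i; rewrite !inE iZ /=.
    case: m1D => [m0|[q qD qm1]]; first by rewrite m0 in im1.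
    have qD1 : q \in D :\ t by apply: D1 => //; lia.
    have [kq|qk] := leqP k q.
      by rewrite andbF /= negbK (@yexp_lt _ q) // ?andbT; lia.
    have := Za i; rewrite iZ /= -leqNgt leqn0 => /eqP ai.
    by have := @xexp_lt _ q ((pi^-1)%g i) q qD1; rewrite -/(cut_x i) ai qm1; lia.
  case: m2D => [m0|[q qD qm2]]; first by have := ltn_ord ((pi^-1)%g i); lia.
  have qD1 : q \in D :\ t by apply: D1 => //; lia.
  by rewrite /= orbF; apply/andP; split; [lia | apply: (@yexp_lt _ q) => //; lia].
have ktF : (k <= t)%N = false by rewrite leqNgt tk.
have cE : cutmono Z = mono (fun i => cut_x i + (i \in Z))%N cut_y.
  by apply: eq_mono => i; rewrite ?ktF ?tk ?addn0.
rewrite cE.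
have [/existsP[i /andP[iZ ai]]|/existsPn Za] := boolP [exists i, (i \in Z) && (0 < cut_y i)%N].
  by apply/memJ/(@xy_Jeta _ _ k_gt0 le_kn _ _ i) => //; rewrite iZ addn1.
have axS i : xexp k D ((pi^-1)%g i) = (cut_x i + (i \in pfx pi t))%N by rewrite -axE tk.
have cP : #|pfx pi t| = t by rewrite card_pfx // ltnW.
apply: (@straighten_Ilt_x _ _ k_gt0 le_kn _ _ _ _ _ _ _ t) => [T|T||||T cT].
- apply: leq_trans (sum_add_indic_pfx T Z ax'_dec) _; rewrite cZ.
  rewrite /xsum -(sum_pfx (fun p : 'I_n => xexp k D p) pi).
  by apply: leq_sum => i _; rewrite axS.
- apply: leq_trans (sum_yexp_le _ _ pi T); apply: leq_sum => i _.
  by rewrite -ayE leq_addr.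
- rewrite [RHS](reindex_inj (@perm_inj _ pi^-1%g)) /=.
  by rewrite [RHS](eq_bigr _ (fun i _ => axS i)) !big_split /= !sum_mem cZ cP.
- rewrite [RHS](reindex_inj (@perm_inj _ pi^-1%g)) /=; apply: eq_bigr => i _.
  by rewrite -ayE ktF addn0.
- exact: ltnW.
rewrite /xsum -(sum_pfx (fun p : 'I_n => xexp k D p) pi) [X in (_ < X)%N](eq_bigr _ (fun i _ => axS i)).
rewrite !big_split /= !sum_indic setIid cP.
have le_T : (\sum_(i in T) cut_x i <= \sum_(i in pfx pi t) cut_x i)%N.
  by have := sum_le_pfx T ax'_dec; rewrite cT.
have [TZ|neqTZ] := eqVneq T Z; last first.
  suff lt_c : (#|T :&: Z| < t)%N by rewrite -addnS; apply: leq_add.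
  rewrite -[X in (_ < X)%N]cT; apply: proper_card; rewrite properE subsetIl /=; apply: contra neqTZ.
  by rewrite subsetI subxx /= => sTZ; rewrite eqEcard sTZ cZ cT /=.
rewrite TZ setIid cZ ltn_add2r.
apply: (@sum_threshold_lt _ _ _ _ (xexp k (D :\ t) t)); first by rewrite cZ cP.
- by move=> i; rewrite !inE => ti; apply/xexp_dec/ltnW.
- by move=> i _; rewrite !inE -leqNgt => ti; apply: xexp_dec.
have [i /orP[/andP[im1 iZ]|/andP[im2 iZ]]] := bad; exists i; rewrite !inE iZ /=.
  case: m1D => [m0|[q qD qm1]]; first by rewrite m0 in im1.
  have qD1 : q \in D :\ t by apply: D1 => //; lia.
  by apply/orP; left; apply/andP; split; [lia | apply: (@xexp_lt _ q) => //; lia].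
case: m2D => [m0|[q qD qm2]]; first by have := ltn_ord ((pi^-1)%g i); lia.
have qD1 : q \in D :\ t by apply: D1 => //; lia.
have [kq|qk] := leqP k q.
  have := Za i; rewrite iZ /= -leqNgt leqn0 => /eqP ai.
  by have := @yexp_lt _ q t ((pi^-1)%g i) qD1; rewrite -/(cut_y i) ai; lia.
by rewrite andbF /= -leqNgt; apply/andP; split; [lia | apply: (@xexp_lt _ q) => //; lia].
Qed.

(** In the relation given by an elementary symmetric polynomial, all the terms but the
    redistributed words are zero modulo J or strictly lower in dominance order. *)
Lemma garnir : \sum_(sg | redist pi m1 t m2 sg) clJ (dmon k D sg) \in Ilt n k (lam_of k pi).
Proof.
rewrite (eq_bigr (fun sg => clJ (cutmono (pfx sg t)))); last by move=> sg /cutmono_redist->.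
rewrite (sum_redist pi m1t tm2 m2n (fun Z => clJ (cutmono Z))).
have := cutmono_sum_Jeta; rewrite -clJ_eq0 clJ_sum (bigID (between pi m1 m2)) /= addr_eq0 => /eqP->.
by apply/lspanN/lspan_sum => Z /andP[/eqP cZ]; exact: cutmono_lower.
Qed.

End Garnir.

(** * The descents next to a cut *)

Section ExtremalCuts.
Variables (n : nat) (P : pred 'I_n).

Lemma maxcutP (m : nat) : m = (\max_(i | P i) i)%N ->
  (m = 0%N \/ exists2 q, P q & q = m :> nat) /\ forall q, P q -> (q <= m)%N.
Proof.
move=> ->; split=> [|q Pq]; last exact: (bigmax_sup q).
apply: (big_ind (fun m => m = 0%N \/ exists2 q, P q & q = m :> nat)) => [|x y Hx Hy|i Pi].
- by left.
- by case: (leqP x y).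
- by right; exists i.
Qed.

Lemma mincutP (m : nat) : m = (\big[minn/n]_(i | P i) i)%N ->
  [/\ m = n \/ exists2 q, P q & q = m :> nat, (m <= n)%N & forall q, P q -> (m <= q)%N].
Proof.
move=> ->; split=> [||q Pq].
- apply: (big_ind (fun m => m = n \/ exists2 q, P q & q = m :> nat)) => [|x y Hx Hy|i Pi].
  + by left.
  + by case: (leqP x y).
  + by right; exists i.
- apply: (big_ind (fun m => m <= n)%N) => // [x y xn yn|i _]; last exact: ltnW.
  by rewrite geq_min xn.
have: q \in index_enum 'I_n by rewrite mem_index_enum.
elim: (index_enum _) => // i r IHr; rewrite inE big_cons.
case/orP => [/eqP<-|/IHr le_q]; first by rewrite Pq geq_minl.
by case: ifP => // _; rewrite geq_min le_q orbT.
Qed.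

End ExtremalCuts.

(** * Coxeter generators on the descent basis *)

Section Coxeter.
Variables n k : nat.
Hypotheses (k_gt0 : (0 < k)%N) (le_kn : (k <= n)%N).
Variable lam : seq nat * seq nat.
Hypothesis lam_bip : is_bipartition n k lam.
Variables (j j' : 'I_n) (pi : 'S_n).
Hypotheses (jE : j' = j.+1 :> nat) (Dlam : Des pi = Alam n k lam).
Let s := tperm j j'.
Let pos := (pi^-1)%g.

Lemma actR_camon : actR s (camon k lam pi) = clI lam (clJ (dmon k (Des pi) (pi * s)%g)).
Proof.
by rewrite /camon (actRE k_gt0 le_kn) actHE /amon actxy_dmon.
Qed.

(** Exchanging the consecutive letters j and j' only affects the comparison of these two. *)
Lemma tperm_lt (x y : 'I_n) : ~ (x = j /\ y = j') -> ~ (x = j' /\ y = j) ->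
  (s x < s y)%N = (x < y)%N.
Proof.
move=> n1 n2; have valE (u v : 'I_n) : u <> v -> u != v :> nat.
  by move=> uv; apply/eqP => /ord_inj.
rewrite /s; case: tpermP => [xE|xE|xj xj']; case: tpermP => [yE|yE|yj yj']; rewrite ?xE ?yE.
- by rewrite !ltnn.
- by case: n1.
- by have := valE _ _ yj; have := valE _ _ yj'; rewrite jE; lia.
- by case: n2.
- by rewrite !ltnn.
- by have := valE _ _ yj; have := valE _ _ yj'; rewrite jE; lia.
- by have := valE _ _ xj; have := valE _ _ xj'; rewrite jE; lia.
- by have := valE _ _ xj; have := valE _ _ xj'; rewrite jE; lia.
- by [].
Qed.

Lemma actR_far : 1 < `|(pos j')%:Z - (pos j)%:Z| ->
  actR s (camon k lam pi) = camon k lam (pi * s)%g.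
Proof.
move=> far; rewrite actR_camon /camon /amon (_ : Des (pi * s)%g = Des pi) //.
apply/setP => q; have [q0|q_gt0] := posnP q; first by rewrite !Des0.
have lt_p : (q.-1 < n)%N by have := ltn_ord q; lia.
have qE : q = (Ordinal lt_p).+1 :> nat by rewrite /= prednK.
rewrite !(DesP _ qE) !permM; apply: tperm_lt => -[e1 e2];
by move: far; rewrite /pos -e1 -e2 !permK; lia.
Qed.

Lemma actR_ascent : pos j' = (pos j).+1 :> nat -> actR s (camon k lam pi) = camon k lam pi.
Proof.
move=> posE; rewrite actR_camon /camon /amon; congr (clI lam (clJ _)).
have ascF : (pos j' \in Des pi) = false.
  by rewrite (DesP _ posE) /pos !permKV jE; lia.
have exE : xexp k (Des pi) (pos j') = xexp k (Des pi) (pos j).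
  have [qk|kq] := ltnP (pos j') k; first by rewrite (xexpS _ posE qk) ascF addn0.
  by rewrite !xexp0 //; lia.
have eyE : yexp k (Des pi) (pos j') = yexp k (Des pi) (pos j).
  have [qk|kq] := ltnP (pos j') k; last by rewrite (yexpS _ posE kq) ascF addn0.
  by rewrite !yexp0 //; lia.
rewrite !dmonE; apply: eq_mono => i; rewrite invMg tpermV permM -/pos /s;
by case: tpermP => [->|->|].
Qed.

(** Both pi and s pi are redistributions of the block around their cut, and the others
    form the set of the formula. *)
Lemma actR_descent : pos j = (pos j').+1 :> nat ->
  actR s (camon k lam pi) = - camon k lam pi - \sum_(sg in Aset pi j j') cmon k lam sg.
Proof.
move=> posE; rewrite actR_camon.
set t := pos j; have tD : t \in Des pi by rewrite (DesP _ posE) /pos !permKV jE; lia.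
pose m1 := (\max_(i in Des pi | (i <= t - 1)%N) i)%N.
pose m2 := (\big[minn/n]_(i in Des pi | (t + 1 <= i)%N) i)%N.
have [m1D m1_max] := maxcutP (erefl m1).
have [m2D m2n m2_min] := mincutP (erefl m2).
have tp : t = (pos j').+1 :> nat by [].
have t_gt0 : (0 < t)%N by rewrite tp.
have m1t : (m1 < t)%N by case: m1D => [->//|[q /andP[_ qt] <-]]; lia.
have tm2 : (t < m2)%N by case: m2D => [->//|[q /andP[_ qt] <-]]; lia.
have gap1 (q : 'I_n) : (m1 < q < t)%N -> q \notin Des pi.
  move=> qm; apply/negP => qD; have := m1_max q; rewrite qD /=; lia.
have gap2 (q : 'I_n) : (t < q < m2)%N -> q \notin Des pi.
  move=> qm; apply/negP => qD; have := m2_min q; rewrite qD /=; lia.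
have m1D' : m1 = 0%N \/ exists2 q : 'I_n, q \in Des pi & q = m1 :> nat.
  by case: m1D => [|[q /andP[qD _] qm]]; [left | right; exists q].
have m2D' : m2 = n \/ exists2 q : 'I_n, q \in Des pi & q = m2 :> nat.
  by case: m2D => [|[q /andP[qD _] qm]]; [left | right; exists q].
have := garnir k_gt0 le_kn tD m1t tm2 m2n gap1 gap2 m1D' m2D'.
rewrite (lam_of_Alam k_gt0 le_kn lam_bip Dlam) -clI_eq0 clI_sum => sum0.
have pi_redist : redist pi m1 t m2 pi.
  apply/(redistP _ m1t tm2 m2n); split=> // p q mp pq qt; apply: run_increasing => // r rpq.
    by apply: gap1; lia.
  by apply: gap2; lia.
have posj : pi t = j by rewrite permKV.
have posj' : pi (pos j') = j' by rewrite permKV.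
have neq_jj' : j != j' by rewrite -val_eqE /= jE; lia.
have pis_redist : redist pi m1 t m2 (pi * s)%g.
  have := pi_redist => /(redistP _ m1t tm2 m2n)[_ H1 H2]; apply/(redistP _ m1t tm2 m2n); split=> [p p_out|p q mp pq qt|p q mp pq qt].
  - rewrite permM /s tpermD //; apply/eqP => e.
      have pt : p = t by apply: (@perm_inj _ pi); rewrite posj.
      by move: p_out; rewrite pt; lia.
    have pt : p = pos j' by apply: (@perm_inj _ pi); rewrite posj'.
    by move: p_out tp m1t tm2; rewrite pt; move: (nat_of_ord (pos j')) (nat_of_ord t) => u v; lia.
  - rewrite !permM tperm_lt; first exact: H1.
      by case=> /(canRL (permK pi)) /(congr1 (@nat_of_ord n)); rewrite -/pos -/t; lia.
    by case=> _ /(canRL (permK pi)) /(congr1 (@nat_of_ord n)); rewrite -/pos -/t; lia.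
  - rewrite !permM tperm_lt; first exact: H2.
      by case=> _ /(canRL (permK pi)) /(congr1 (@nat_of_ord n)); rewrite -/pos -/t; lia.
    by case=> /(canRL (permK pi)) /(congr1 (@nat_of_ord n)); rewrite -/pos -/t; lia.
have pis_neq : (pi * s)%g != pi.
  by apply: contra neq_jj' => /eqP/permP/(_ t); rewrite permM posj /s tpermL => ->.
have tE : ((pi^-1)%g j').+1 = t by rewrite -/pos -posE.
move: sum0; rewrite (bigD1 pi) // (bigD1 (pi * s)%g) ?pis_redist //=.
have solve (V : zmodType) (x y z : V) : x + (y + z) = 0 -> x = - y - z.
  by move/eqP; rewrite addr_eq0 opprD => /eqP.
rewrite addrCA => /eqP/solve ->; congr (- _ - _).
apply: eq_big => [sg|sg _]; last by rewrite /cmon -Dlam.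
rewrite /Aset tE -/m1 -/m2 [RHS]inE !inE negb_or /redist -!andbA.
by do 3!congr (_ && _).
Qed.

End Coxeter.

Theorem theorem1p12 (n k : nat) (hk : (1 <= k <= n)%N)
    (lam : seq nat * seq nat) (hlam : is_bipartition n k lam) :
  [/\ forall s : 'S_n,
        [/\ {homo actxy s : f / f \in Jeta n k},
            {homo actH s : u / u \in Ile n k lam} &
            {homo actH s : u / u \in Ilt n k lam}],
      is_basis [pred pi : 'S_n | Des pi == Alam n k lam]
        (camon k lam) (Rlam n k lam) &
      forall (j j' : 'I_n) (pi : 'S_n),
        j' = j.+1 :> nat -> Des pi = Alam n k lam ->
        let s := tperm j j' in
        let pos := (pi^-1)%g in
        [/\ 1 < `|(pos j')%:Z - (pos j)%:Z| ->
              actR s (camon k lam pi) = camon k lam (pi * s)%g,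
            pos j' = (pos j).+1 :> nat ->
              actR s (camon k lam pi) = camon k lam pi &
            pos j = (pos j').+1 :> nat ->
              actR s (camon k lam pi) =
                - camon k lam pi - \sum_(sg in Aset pi j j') cmon k lam sg]].
Proof.
case/andP: hk => k_gt0 le_kn; split=> [s||j j' pi jE Dlam s pos].
- split=> [f Jf|u|u]; [exact: Jeta_act | exact: actH_Ile | exact: actH_Ilt].
- exact: camon_basis.
split; [exact: actR_far | exact: actR_ascent | exact: actR_descent].
Qed.
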